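(* Let $(M^3,g(t))$ be a $3$-dimensional Riemannian manifold evolving by the Ricci flow $\frac{\partial}{\partial t}g_{ij}=-2R_{ij}$ on some time interval. Then the Cotton tensor satisfies \begin{align*} (\partial_t-\Delta)C_{ijk}={}&g^{pq}R_{pj}(C_{kqi}+C_{qki})+5g^{pq}R_{ip}C_{qkj}+g^{pq}R_{pk}(C_{jiq}+C_{qij})\\ &+2R\,C_{ijk}+2R^{ql}C_{qjl}g_{ik}-2R^{ql}C_{qkl}g_{ij}\\ &+\tfrac12\nabla_k|\mathrm{Ric}|^2g_{ij}-\tfrac12\nabla_j|\mathrm{Ric}|^2g_{ik}+\tfrac{R}{2}\nabla_jR\,g_{ik}-\tfrac{R}{2}\nabla_kR\,g_{ij}\\ &+2g^{pq}R_{pk}\nabla_jR_{qi}-2g^{pq}R_{pj}\nabla_kR_{qi}+R_{ij}\nabla_kR-R_{ik}\nabla_jR . \end{align*} In particular, if the Cotton tensor vanishes identically along the flow, then \begin{align*} 0={}&\nabla_k|\mathrm{Ric}|^2g_{ij}-\nabla_j|\mathrm{Ric}|^2g_{ik}+R\nabla_jR\,g_{ik}-R\nabla_kR\,g_{ij}\\ &+4g^{pq}R_{pk}\nabla_jR_{qi}-4g^{pq}R_{pj}\nabla_kR_{qi}+2R_{ij}\nabla_kR-2R_{ik}\nabla_jR . \end{align*}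
   Context: Repeated indices are summed. $R_{ij}$ is the Ricci tensor (denoted $\mathrm{Ric}$; normalized to be positive on round spheres), $R=g^{ij}R_{ij}$ is the scalar curvature, $R^{ql}=g^{qa}g^{lb}R_{ab}$, $|\mathrm{Ric}|^2=R^{ij}R_{ij}$, $\nabla$ is the Levi-Civita connection of $g(t)$ and $\Delta=g^{ab}\nabla_a\nabla_b$ is the rough Laplacian on tensors. The Cotton tensor in dimension three is $$C_{ijk}=\nabla_kR_{ij}-\nabla_jR_{ik}-\tfrac14\big(\nabla_kR\,g_{ij}-\nabla_jR\,g_{ik}\big).$$ Components are taken with respect to a fixed (time-independent) local coordinate frame, not a moving frame; $\partial_tC_{ijk}$ is the time derivative of these components. *)

(* Defs.v *)
From HB Require Import structures.
From mathcomp Require Import all_boot all_order all_algebra.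
From mathcomp Require Import all_classical all_reals all_analysis.

Set Implicit Arguments.
Unset Strict Implicit.
Unset Printing Implicit Defensive.
Import Order.TTheory GRing.Theory Num.Theory.
Import numFieldNormedType.Exports.
Local Open Scope classical_set_scope.
Local Open Scope ring_scope.

Section Calculus.
Context {R : realType}.
Local Notation E := 'rV[R]_3.

Definition partial (i : 'I_3) (f : E -> R) : E -> R :=
  fun x => 'D_(delta_mx 0 i) f x.

Definition smooth_on (U : set E) (f : E -> R) : Prop :=
  forall (ds : seq 'I_3) (x : E), U x ->
    {for x, continuous (foldr partial f ds)} /\
    forall i, derivable (foldr partial f ds) x (delta_mx 0 i).

(* Time derivatives are taken within the time interval [I]: they are ordinary
   derivatives at interior points and one-sided ones at endpoints in [I]. *)
Definition time_quotient (f : R -> R) (t : R) : R -> R :=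
  fun s => (s - t)^-1 * (f s - f t).

Definition time_derivable (I : set R) (f : R -> R) (t : R) : Prop :=
  cvg (time_quotient f t @ within I t^').

Definition time_derive (I : set R) (f : R -> R) (t : R) : R :=
  lim (time_quotient f t @ within I t^').

(* [None] stands for the time direction, [Some i] for the i-th coordinate. *)
Definition st_partial (I : set R) (d : option 'I_3) (f : R -> E -> R) :
    R -> E -> R :=
  fun t x => if d is Some i then partial i (f t) x
             else time_derive I (f ^~ x) t.

Definition st_derivable (I : set R) (d : option 'I_3) (f : R -> E -> R)
    (t : R) (x : E) : Prop :=
  if d is Some i then derivable (f t) x (delta_mx 0 i)
  else time_derivable I (f ^~ x) t.

Definition st_smooth_on (I : set R) (U : set E) (f : R -> E -> R) : Prop :=
  forall ds : seq (option 'I_3),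
    let h := foldr (st_partial I) f ds in
    {within I `*` U, continuous (fun p : R * E => h p.1 p.2)} /\
    forall t x, I t -> U x -> forall d, st_derivable I d h t x.

End Calculus.

(* The atlas is arbitrary, not assumed maximal: a property of all its charts
   covers all coordinate systems of the smooth structure by taking for it the
   maximal atlas. *)
Record manifold3 (R : realType) := Manifold3 {
  carrier :> topologicalType;
  carrier_hausdorff : hausdorff_space carrier;
  carrier_second_countable : @second_countable carrier;
  chart : Type;
  chart_dom : chart -> set carrier;
  chart_map : chart -> carrier -> 'rV[R]_3;
  chart_param : chart -> 'rV[R]_3 -> carrier;
  chart_dom_open : forall c, open (chart_dom c);
  chart_dom_cover : forall p, exists c, chart_dom c p;
  chart_range_open : forall c, open (chart_map c @` chart_dom c);
  chart_mapK : forall c p, chart_dom c p -> chart_param c (chart_map c p) = p;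
  chart_map_continuous : forall c p, chart_dom c p ->
    {for p, continuous (chart_map c)};
  chart_param_continuous : forall c x, (chart_map c @` chart_dom c) x ->
    {for x, continuous (chart_param c)};
  transition_smooth : forall c d (i : 'I_3),
    smooth_on (chart_map c @` (chart_dom c `&` chart_dom d))
      (fun x => chart_map d (chart_param c x) 0 i)
}.

(* The Euclidean open set on which the tensor components in chart [c] live. *)
Definition chart_range (R : realType) (M : manifold3 R) (c : chart M) :
  set 'rV[R]_3 := chart_map c @` chart_dom c.

Definition transition (R : realType) (M : manifold3 R) (c d : chart M)
  (x : 'rV[R]_3) : 'rV[R]_3 := chart_map d (chart_param c x).

Section LocalGeometry.
Context {R : realType}.
Local Notation E := 'rV[R]_3.
Implicit Types (g : E -> 'M[R]_3) (i j k l m a b : 'I_3) (x : E).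

Definition ginv g i j x : R := invmx (g x) i j.

(* [christoffel g k i j] is Gamma^k_{ij}. *)
Definition christoffel g k i j x : R :=
  2^-1 * \sum_l ginv g k l x *
    (partial i (fun y => g y j l) x + partial j (fun y => g y i l) x
     - partial l (fun y => g y i j) x).

(* [riemann g l k i j] is the dx^l-component of
   (nabla_i nabla_j - nabla_j nabla_i) applied to the k-th frame field. *)
Definition riemann g l k i j x : R :=
  partial i (christoffel g l j k) x - partial j (christoffel g l i k) x
  + \sum_m (christoffel g l i m x * christoffel g m j k x
            - christoffel g l j m x * christoffel g m i k x).

Definition ricci g i j x : R := \sum_l riemann g l i l j x.

Definition scal g x : R := \sum_i \sum_j ginv g i j x * ricci g i j x.

Definition ricci_up g i j x : R :=
  \sum_a \sum_b ginv g i a x * ginv g j b x * ricci g a b x.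

Definition ricci_norm2 g x : R :=
  \sum_i \sum_j ricci_up g i j x * ricci g i j x.

(* Components of the covariant derivative of covariant tensors of rank 2, 3
   and 4; the index of differentiation comes first. *)
Definition nabla2 g (T : 'I_3 -> 'I_3 -> E -> R) a i j x : R :=
  partial a (T i j) x
  - \sum_m christoffel g m a i x * T m j x
  - \sum_m christoffel g m a j x * T i m x.

Definition nabla3 g (T : 'I_3 -> 'I_3 -> 'I_3 -> E -> R) a i j k x : R :=
  partial a (T i j k) x
  - \sum_m christoffel g m a i x * T m j k x
  - \sum_m christoffel g m a j x * T i m k x
  - \sum_m christoffel g m a k x * T i j m x.

Definition nabla4 g (T : 'I_3 -> 'I_3 -> 'I_3 -> 'I_3 -> E -> R)
    a i j k l x : R :=
  partial a (T i j k l) x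
  - \sum_m christoffel g m a i x * T m j k l x
  - \sum_m christoffel g m a j x * T i m k l x
  - \sum_m christoffel g m a k x * T i j m l x
  - \sum_m christoffel g m a l x * T i j k m x.

Definition laplacian3 g (T : 'I_3 -> 'I_3 -> 'I_3 -> E -> R) i j k x : R :=
  \sum_a \sum_b ginv g a b x * nabla4 g (nabla3 g T) a b i j k x.

Definition cotton g i j k x : R :=
  nabla2 g (ricci g) k i j x - nabla2 g (ricci g) j i k x
  - 4^-1 * (partial k (scal g) x * g x i j - partial j (scal g) x * g x i k).

End LocalGeometry.

Section Flow.
Context {R : realType} {M : manifold3 R}.

(* A smooth family, indexed by [t] in [I], of Riemannian metrics on [M], given
   by its matrices of components in all charts. *)
Record metric_family (I : set R)
    (g : chart M -> R -> 'rV[R]_3 -> 'M[R]_3) : Prop := MetricFamily {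
  metric_smooth : forall c i j,
    st_smooth_on I (chart_range c) (fun t x => g c t x i j);
  metric_sym : forall c t x, I t -> chart_range c x -> (g c t x)^T = g c t x;
  metric_pos : forall c t x (v : 'rV[R]_3), I t -> chart_range c x -> v != 0 ->
    0 < (v *m g c t x *m v^T) 0 0;
  metric_transform : forall c d t x i j, I t ->
    (chart_map c @` (chart_dom c `&` chart_dom d)) x ->
    g c t x i j = \sum_a \sum_b
      partial i (fun y => transition c d y 0 a) x *
      partial j (fun y => transition c d y 0 b) x *
      g d t (transition c d x) a b
}.

Definition ricci_flow (I : set R)
    (g : chart M -> R -> 'rV[R]_3 -> 'M[R]_3) : Prop :=
  metric_family I g /\
  forall c t x i j, I t -> chart_range c x ->
    time_derive I (fun s => g c s x i j) t = - 2 * ricci (g c t) i j x.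

End Flow.

(* Main.v *)
Require Import Defs.
From HB Require Import structures.
From mathcomp Require Import all_boot all_order all_algebra.
From mathcomp Require Import all_classical all_reals all_analysis.
From mathcomp Require Import ring lra.
Set Implicit Arguments.
Unset Strict Implicit.
Unset Printing Implicit Defensive.
Import Order.TTheory GRing.Theory Num.Theory.
Import numFieldNormedType.Exports.
Local Open Scope classical_set_scope.
Local Open Scope ring_scope.

(** The proof separates tensor algebra from analysis.

    In one chart, the functions of (t, x) that are smooth up to the ends of the
    time interval form a commutative ring, on which the time derivative and the
    three coordinate derivatives act as commuting derivations.  The components
    of the metric and of its inverse lie in this ring, and the Ricci flow is an
    identity of ring elements.  The evolution equation follows from these facts
    alone, so it is proved as [DiffAlg.cotton_evolution_alg] in an arbitrary
    commutative ring with commuting derivations and an element 1/2.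

    The algebra is organised around the Schouten tensor P = Ric - (R/4) g and
    its trace J = R/4.  In dimension three there is no Weyl tensor, so the
    curvature is the Kulkarni-Nomizu product of P and g ([rm_decomp]); hence the
    commutator of two covariant derivatives is an explicit contraction with P
    ([sum_rm]).  The contracted second Bianchi identity becomes div P = dJ
    ([div_P]), and the Cotton tensor becomes
    C_ijk = nabla_k P_ij - nabla_j P_ik ([cotton_tensorE]).  Under the flow,
    d_t P = Delta P - 6 P^2 + 2 J P + (3/2 |P|^2 - 1/2 J^2) g ([Dt_P]).
    Differentiating this once produces nabla_k Delta P_ij, while Delta C contains
    Delta nabla_k P_ij; the third derivatives of P cancel and the commutator
    [trace_nab4_hessP] remains, which is again bilinear in P and nabla P.  Both
    sides of the evolution equation are then linear combinations of the same few
    contractions of P with nabla P, and comparing coefficients ends the proof.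
    If C vanishes identically, so does the left-hand side, and twice the
    right-hand side is the second identity.

    The analytic part shows that the ring just described exists.  Smoothness is
    stable under products and inverses, hence the inverse metric is smooth; and
    the partial derivatives commute, including the one-sided time derivative at
    an end of the interval ([mixed_time_derive]), by two applications of the
    mean value theorem. *)

(** * Sums over three indices *)

Module DiffAlg.

Section IndexSums.
Variable A : comPzRingType.

Definition o0 : 'I_3 := ord0.
Definition o1 : 'I_3 := lift ord0 ord0.
Definition o2 : 'I_3 := lift ord0 (lift ord0 ord0).

(** The basic tool: once all sums are expanded, a tensor identity with free
    indices is an identity between polynomials in the components, which [ring]
    decides. *)
Lemma sum3 (F : 'I_3 -> A) : \sum_i F i = F o0 + F o1 + F o2.
Proof. by rewrite !big_ord_recl big_ord0 addr0 addrA. Qed.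

Lemma I3_ind (B : 'I_3 -> Prop) : B o0 -> B o1 -> B o2 -> forall i, B i.
Proof.
move=> q0 q1 q2 [[|[|[|//]]] lt_i].
- by rewrite (_ : Ordinal lt_i = o0) //; apply: val_inj.
- by rewrite (_ : Ordinal lt_i = o1) //; apply: val_inj.
- by rewrite (_ : Ordinal lt_i = o2) //; apply: val_inj.
Qed.

Definition delta (i j : 'I_3) : A := (i == j)%:R.

Lemma deltaC i j : delta i j = delta j i.
Proof. by rewrite /delta eq_sym. Qed.

Lemma delta_diag i : delta i i = 1.
Proof. by rewrite /delta eqxx. Qed.

Lemma deltaE : (delta o0 o1 = 0) * (delta o0 o2 = 0) * (delta o1 o2 = 0) *
  (delta o1 o0 = 0) * (delta o2 o0 = 0) * (delta o2 o1 = 0).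
Proof. by []. Qed.

Lemma sum_delta i (X : 'I_3 -> A) : \sum_m delta i m * X m = X i.
Proof.
rewrite (bigD1 i) //= big1 ?addr0 ?/delta ?eqxx ?mul1r // => m ne_mi.
by rewrite eq_sym (negPf ne_mi) mul0r.
Qed.

End IndexSums.

(** * Riemannian geometry in a ring with commuting derivations *)

Section Riemannian.
(* [D] are the coordinate derivatives, [g] is the metric and [H] its inverse. *)
Variables (A : comPzRingType) (half : A) (D : 'I_3 -> A -> A).
Variables (g H : 'I_3 -> 'I_3 -> A).
Hypothesis half2 : half + half = 1.
Hypothesis D_add : forall i x y, D i (x + y) = D i x + D i y.
Hypothesis D_mul : forall i x y, D i (x * y) = D i x * y + x * D i y.
Hypothesis DC : forall i j x, D i (D j x) = D j (D i x).
Hypothesis gC : forall i j, g i j = g j i.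
Hypothesis HC : forall i j, H i j = H j i.
Hypothesis Hg : forall i j, \sum_m H i m * g m j = delta A i j.

(** [ring] knows nothing about [half], so every cancellation of a factor two goes
    through this lemma. *)
Lemma halfM (x : A) : half * (x + x) = x.
Proof. by rewrite -[in RHS](mul1r x) -half2; ring. Qed.

Lemma double_eq0 (x : A) : x + x = 0 -> x = 0.
Proof. by move=> xx; rewrite -(halfM x) xx mulr0. Qed.

Lemma D0 i : D i 0 = 0.
Proof. by apply: (@addIr A (D i 0)); rewrite -D_add !add0r. Qed.

Lemma D_opp i x : D i (- x) = - D i x.
Proof. by apply/eqP; rewrite -addr_eq0 -D_add addNr D0. Qed.

Lemma D1 i : D i 1 = 0.
Proof.
by apply: (@addIr A (D i 1)); rewrite add0r -[in RHS](mulr1 1) D_mul mulr1 mul1r.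
Qed.

Lemma Dnat i n : D i n%:R = 0.
Proof. by elim: n => [|n IH]; rewrite ?D0 // mulrS D_add D1 IH addr0. Qed.

Lemma Dhalf i : D i half = 0.
Proof. by apply: double_eq0; rewrite -D_add half2 D1. Qed.

Definition HC_sort := (HC o1 o0, HC o2 o0, HC o2 o1).

Definition gC_sort := (gC o1 o0, gC o2 o0, gC o2 o1).

Definition DE := (D_add, D_opp, D_mul, Dhalf, Dnat, D1, D0).

Lemma gH i j : \sum_m g i m * H m j = delta A i j.
Proof. by rewrite deltaC -Hg; apply: eq_bigr => m _; rewrite mulrC HC gC. Qed.

Lemma lower_raise k (X : 'I_3 -> A) :
  \sum_m g k m * (\sum_l H m l * X l) = X k.
Proof.
rewrite -[RHS](sum_delta k X).
under [RHS]eq_bigr => l _ do rewrite -gH.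
by rewrite !sum3; ring.
Qed.

Lemma raise_lower k (X : 'I_3 -> A) :
  \sum_m H k m * (\sum_l g m l * X l) = X k.
Proof.
rewrite -[RHS](sum_delta k X).
under [RHS]eq_bigr => l _ do rewrite -Hg.
by rewrite !sum3; ring.
Qed.

Lemma lower_inj (X Y : 'I_3 -> A) :
  (forall k, \sum_m g k m * X m = \sum_m g k m * Y m) -> forall k, X k = Y k.
Proof.
move=> eXY k; rewrite -(raise_lower k X) -(raise_lower k Y).
by apply: eq_bigr => m _; rewrite eXY.
Qed.

Definition dot (X Y : 'I_3 -> A) : A := \sum_p \sum_q H p q * X p * Y q.

Definition trace (T : 'I_3 -> 'I_3 -> A) : A := \sum_p \sum_q H p q * T p q.

Lemma dotC X Y : dot X Y = dot Y X.
Proof. by rewrite /dot exchange_big; do 2!apply: eq_bigr => ? _; rewrite HC; ring. Qed.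

(** Contraction with a row of the metric renames an index.  This is how all
    contractions containing [g] disappear. *)
Lemma dot_g k Y : dot (g k) Y = Y k.
Proof.
rewrite -[RHS](lower_raise k) /dot.
by apply: eq_bigr => p _; rewrite mulr_sumr; apply: eq_bigr => q _; ring.
Qed.

Lemma eq_trace T1 T2 : (forall p q, T1 p q = T2 p q) -> trace T1 = trace T2.
Proof. by move=> eT; do 2!apply: eq_bigr => ? _; rewrite eT. Qed.

Lemma traceC T : trace T = trace (fun p q => T q p).
Proof. by rewrite /trace exchange_big; do 2!apply: eq_bigr => ? _; rewrite HC. Qed.

Lemma trace_g : trace g = 3%:R.
Proof.
rewrite /trace (eq_bigr (fun p => delta A p p)); first by rewrite sum3 !delta_diag; ring.
by move=> p _; rewrite -Hg; apply: eq_bigr => q _; rewrite (gC p q).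
Qed.

(** The Christoffel symbols.  They are locked, as are the other quantities below
    whose derivatives occur: rewriting with the Leibniz rule would otherwise look
    for products and sums under their definitions. *)
Definition gam k i j : A :=
  locked (half * \sum_l H k l * (D i (g j l) + D j (g i l) - D l (g i j))).

Lemma gamC k i j : gam k i j = gam k j i.
Proof.
rewrite /gam -!lock; congr (_ * _).
by apply: eq_bigr => l _; rewrite (gC i j); ring.
Qed.

Lemma gam_lower k i j :
  \sum_m g k m * gam m i j = half * (D i (g j k) + D j (g i k) - D k (g i j)).
Proof.
rewrite -(lower_raise k (fun l => D i (g j l) + D j (g i l) - D l (g i j))).
by rewrite mulr_sumr; apply: eq_bigr => m _; rewrite /gam -lock; ring.
Qed.

Lemma Dg a i j :
  D a (g i j) = \sum_m gam m a i * g m j + \sum_m gam m a j * g i m.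
Proof.
rewrite (eq_bigr (fun m => g j m * gam m a i)); last first.
  by move=> m _; rewrite gC mulrC.
rewrite [X in _ + X](eq_bigr (fun m => g i m * gam m a j)); last first.
  by move=> m _; rewrite mulrC.
rewrite !gam_lower (gC a i) (gC a j) (gC j i) -mulrDr -[LHS]halfM.
by congr (_ * _); ring.
Qed.

(** Differentiate [Hg] and use that the metric is parallel. *)
Lemma DH a i j :
  D a (H i j) = - \sum_m gam i a m * H m j - \sum_m gam j a m * H i m.
Proof.
move: j; apply: lower_inj => j.
have e1 : \sum_m D a (H i m) * g m j + \sum_m H i m * D a (g m j) = 0.
  have := congr1 (D a) (Hg i j); rewrite /delta Dnat => e; rewrite -[RHS]e.
  by rewrite !sum3 !DE; ring.
have e2 : \sum_p gam i a p * (\sum_m H p m * g m j) = gam i a j.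
  rewrite -[RHS](sum_delta j (gam i a)); apply: eq_bigr => p _.
  by rewrite Hg deltaC mulrC.
have e3 : \sum_m H i m * (\sum_p g m p * gam p a j) = gam i a j.
  exact: (raise_lower i (fun p => gam p a j)).
transitivity (\sum_m D a (H i m) * g m j).
  by apply: eq_bigr => m _; rewrite mulrC gC.
apply/eqP; rewrite -subr_eq0; apply/eqP.
transitivity (\sum_p gam i a p * (\sum_m H p m * g m j)
   - \sum_m H i m * (\sum_p g m p * gam p a j)
   + (\sum_m D a (H i m) * g m j + \sum_m H i m * D a (g m j)));
  last by rewrite e1 e2 e3; ring.
under [X in _ + (_ + X)]eq_bigr => m _ do rewrite Dg.
by rewrite !sum3 !(gC j); ring.
Qed.

(** Covariant derivatives of covariant tensors of rank 1 to 4, the index of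
    differentiation first. *)
Definition nab1 (T : 'I_3 -> A) a i : A := D a (T i) - \sum_m gam m a i * T m.

Definition nab2 (T : 'I_3 -> 'I_3 -> A) a i j : A := D a (T i j)
  - \sum_m gam m a i * T m j
  - \sum_m gam m a j * T i m.

Definition nab3 (T : 'I_3 -> 'I_3 -> 'I_3 -> A) a i j k : A := D a (T i j k)
  - \sum_m gam m a i * T m j k
  - \sum_m gam m a j * T i m k
  - \sum_m gam m a k * T i j m.

Definition nab4 (T : 'I_3 -> 'I_3 -> 'I_3 -> 'I_3 -> A) a i j k l : A :=
  D a (T i j k l)
  - \sum_m gam m a i * T m j k l
  - \sum_m gam m a j * T i m k l
  - \sum_m gam m a k * T i j m l
  - \sum_m gam m a l * T i j k m.

Definition rm l k i j : A := D i (gam l j k) - D j (gam l i k)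
  + \sum_m (gam l i m * gam m j k - gam l j m * gam m i k).

Definition ric i j : A := \sum_l rm l i l j.

Definition scal : A := \sum_i \sum_j H i j * ric i j.

Lemma nab2_g : nab2 g = fun _ _ _ => 0.
Proof. by do 3!apply: funext => ?; rewrite /nab2 Dg; ring. Qed.

Lemma ricci_id2 T a b i j :
  nab3 (nab2 T) a b i j - nab3 (nab2 T) b a i j =
  - \sum_m rm m i a b * T m j - \sum_m rm m j a b * T i m.
Proof.
by rewrite /nab3 /nab2 /rm !sum3 !DE !(DC b a) !(gamC _ b a); ring.
Qed.

Lemma ricci_id3 T a b i j k :
  nab4 (nab3 T) a b i j k - nab4 (nab3 T) b a i j k =
  - \sum_m rm m i a b * T m j k - \sum_m rm m j a b * T i m k
  - \sum_m rm m k a b * T i j m.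
Proof.
by rewrite /nab4 /nab3 /rm !sum3 !DE !(DC b a) !(gamC _ b a); ring.
Qed.

Lemma rm_anti l k i j : rm l k i j = - rm l k j i.
Proof. by rewrite /rm !sum3; ring. Qed.

Lemma bianchi1 l k i j : rm l k i j + rm l i j k + rm l j k i = 0.
Proof.
rewrite /rm !sum3 (gamC _ k i) (gamC _ j i) (gamC _ k j).
by rewrite !(gamC _ k i) !(gamC _ j i) !(gamC _ k j); ring.
Qed.

(** The Ricci identity for the metric, which is parallel. *)
Lemma rm_lower_anti i j a b :
  \sum_m rm m i a b * g m j + \sum_m rm m j a b * g i m = 0.
Proof.
have := ricci_id2 g a b i j; rewrite nab2_g /nab3 !sum3 !DE => e.
by apply/eqP; rewrite -oppr_eq0; apply/eqP; rewrite opprD -e; ring.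
Qed.

(** The curvature with its second index raised.  In this form its traces do not
    involve the metric, which makes the three-dimensional decomposition a finite
    computation. *)
Definition rm_up p q i j : A := \sum_k H q k * rm p k i j.

Lemma rm_up_anti p q i j : rm_up p q i j = - rm_up q p i j.
Proof.
apply/eqP; rewrite -addr_eq0; apply/eqP.
transitivity (\sum_k H p k * \sum_l H q l *
  (\sum_m rm m k i j * g m l + \sum_m rm m l i j * g k m)); last first.
  by under eq_bigr do under eq_bigr do rewrite rm_lower_anti mulr0; rewrite !sum3; ring.
transitivity (\sum_k H p k * (\sum_l H q l * (\sum_m g l m * rm m k i j))
  + \sum_l H q l * (\sum_k H p k * (\sum_m g k m * rm m l i j))); last first.
  by under [in RHS]eq_bigr do under eq_bigr do under [X in X + _]eq_bigr do rewrite gC;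
     rewrite !sum3; ring.
rewrite addrC; congr (_ + _).
  by apply: eq_bigr => k _; rewrite (raise_lower q (fun m => rm m k i j)).
by apply: eq_bigr => k _; rewrite (raise_lower p (fun m => rm m k i j)).
Qed.

(** * The curvature in dimension three *)

Lemma rm_up_antir p q i j : rm_up p q i j = - rm_up p q j i.
Proof. by rewrite /rm_up -sumrN; apply: eq_bigr => k _; rewrite rm_anti mulrN. Qed.

Lemma rm_up_diag p i j : rm_up p p i j = 0.
Proof. by apply: double_eq0; rewrite {1}rm_up_anti addNr. Qed.

Lemma rm_up_diagr p q i : rm_up p q i i = 0.
Proof. by apply: double_eq0; rewrite {1}rm_up_antir addNr. Qed.

Definition ric_mix q j : A := \sum_k H q k * ric k j.

Lemma ric_mixE q j : ric_mix q j = \sum_l rm_up l q l j.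
Proof. by rewrite /ric_mix /ric /rm_up !sum3; ring. Qed.

Lemma scalE : scal = \sum_j ric_mix j j.
Proof.
by rewrite /ric_mix /scal exchange_big; do 2!apply: eq_bigr => ? _; rewrite HC.
Qed.

Lemma half_scal : half * scal = rm_up o0 o1 o0 o1 + rm_up o0 o2 o0 o2 + rm_up o1 o2 o1 o2.
Proof.
rewrite -[RHS]halfM; congr (_ * _).
rewrite scalE; under eq_bigr do rewrite ric_mixE.
rewrite !sum3 !rm_up_diag (rm_up_anti o1 o0) (rm_up_anti o2 o0) (rm_up_anti o2 o1).
by rewrite (rm_up_antir _ _ o1 o0) (rm_up_antir _ _ o2 o0) (rm_up_antir _ _ o2 o1); ring.
Qed.

(** In dimension three a pair of distinct indices omits just one index, so each
    component of a tensor antisymmetric in both pairs is a linear combination of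
    traces; the 81 choices of indices are checked one by one. *)
Lemma rm_up_decomp p q i j : rm_up p q i j =
  delta A p i * ric_mix q j - delta A p j * ric_mix q i
  + delta A q j * ric_mix p i - delta A q i * ric_mix p j
  - half * scal * (delta A p i * delta A q j - delta A p j * delta A q i).
Proof.
rewrite half_scal !ric_mixE !sum3.
move: p q i j; do 4!apply: I3_ind;
rewrite ?delta_diag ?deltaE ?rm_up_diag ?rm_up_diagr
 ?(rm_up_anti o1 o0) ?(rm_up_anti o2 o0) ?(rm_up_anti o2 o1)
 ?(rm_up_antir _ _ o1 o0) ?(rm_up_antir _ _ o2 o0) ?(rm_up_antir _ _ o2 o1); ring.
Qed.

Lemma rm_of_rm_up p k i j : rm p k i j = \sum_q g k q * rm_up p q i j.
Proof. by rewrite (lower_raise k (fun k => rm p k i j)). Qed.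

(** [J] and [P] are the trace and the components of the Schouten tensor. *)
Definition J : A := locked (half * half * scal).

Definition P i j : A := locked (ric i j - J * g i j).

Definition P_mix p i : A := \sum_k H p k * P k i.

Lemma half_scalJ : half * scal = J + J.
Proof. by rewrite /J -lock -[half * scal in LHS]mul1r -half2; ring. Qed.

Lemma scalJ : scal = J + J + (J + J).
Proof. by rewrite -half_scalJ -mulrDl half2 mul1r. Qed.

Lemma ricE i j : ric i j = P i j + J * g i j.
Proof. by rewrite /P -lock subrK. Qed.

Lemma ric_mix_P_mix p i : ric_mix p i = P_mix p i + J * delta A p i.
Proof.
rewrite /ric_mix /P_mix -Hg; under eq_bigr do rewrite ricE.
by rewrite !sum3; ring.
Qed.

(** Absence of the Weyl tensor: the curvature is the Kulkarni-Nomizu product of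
    [P] with the metric. *)
Lemma rm_decomp p k i j : rm p k i j =
  delta A p i * P k j - delta A p j * P k i + g k j * P_mix p i - g k i * P_mix p j.
Proof.
rewrite rm_of_rm_up; under eq_bigr do rewrite rm_up_decomp half_scalJ.
transitivity (delta A p i * (\sum_q g k q * ric_mix q j)
  - delta A p j * (\sum_q g k q * ric_mix q i)
  + (\sum_q delta A j q * g k q) * ric_mix p i - (\sum_q delta A i q * g k q) * ric_mix p j
  - (J + J) * (delta A p i * (\sum_q delta A j q * g k q)
                - delta A p j * (\sum_q delta A i q * g k q))).
  by rewrite !sum3 !(deltaC _ _ i) !(deltaC _ _ j); ring.
by rewrite !lower_raise !sum_delta !ric_mix_P_mix !ricE; ring.
Qed.

(** By the first Bianchi identity the antisymmetric part of the Ricci tensor is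
    the trace of the curvature over its first pair, which is antisymmetric. *)
Lemma ricC i j : ric i j = ric j i.
Proof.
have e : \sum_l rm l l i j = 0.
  transitivity (\sum_l \sum_q g l q * rm_up l q i j).
    by apply: eq_bigr => l _; rewrite rm_of_rm_up.
  rewrite !sum3 !rm_up_diag (rm_up_anti o1 o0) (rm_up_anti o2 o0) (rm_up_anti o2 o1).
  by rewrite (gC o1 o0) (gC o2 o0) (gC o2 o1); ring.
apply/eqP; rewrite -subr_eq0; apply/eqP.
transitivity (\sum_l rm l l i j - \sum_l (rm l l i j + rm l i j l + rm l j l i)).
  by rewrite /ric !sum3 !(rm_anti _ i j); ring.
by rewrite e; under eq_bigr do rewrite bianchi1; rewrite !sum3; ring.
Qed.

Lemma PC i j : P i j = P j i.
Proof. by rewrite /P -!lock ricC gC. Qed.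

Lemma trace_linear T1 T2 c :
  trace (fun p q => T1 p q + c * T2 p q) = trace T1 + c * trace T2.
Proof. by rewrite /trace !sum3; ring. Qed.

Lemma trace_P : trace P = J.
Proof.
have : scal = trace P + J * trace g.
  rewrite -trace_linear; do 2!apply: eq_bigr => ? _; by rewrite ricE.
rewrite scalJ trace_g => e.
by apply: (@addIr A (J * 3%:R)); rewrite -e; ring.
Qed.

(** What the commutator of two covariant derivatives does to one index. *)
Lemma sum_rm k i j X : \sum_p rm p k i j * X p =
  P k j * X i - P k i * X j + g k j * dot (P i) X - g k i * dot (P j) X.
Proof.
under eq_bigr do rewrite rm_decomp.
have e a : dot (P a) X = \sum_p P_mix p a * X p.
  by rewrite dotC /dot /P_mix; apply: eq_bigr => p _; rewrite !sum3 !(PC _ a); ring.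
rewrite !e -(sum_delta i X) -(sum_delta j X) !sum3.
by rewrite !(deltaC _ _ i) !(deltaC _ _ j); ring.
Qed.

(** The metric being parallel, contractions commute with covariant
    differentiation. *)
Lemma D_trace a T : D a (trace T) = trace (nab2 T a).
Proof. by rewrite /trace /nab2 !sum3 !DE !DH !sum3 !HC_sort; ring. Qed.

Lemma nab1_trace a T i :
  nab1 (fun i => trace (fun p q => T p q i)) a i = trace (fun p q => nab3 T a p q i).
Proof. by rewrite /trace /nab3 /nab1 !sum3 !DE !DH !sum3 !HC_sort; ring. Qed.

Lemma nab2_trace a T i j :
  nab2 (fun i j => trace (fun p q => T p q i j)) a i j =
  trace (fun p q => nab4 T a p q i j).
Proof. by rewrite /trace /nab4 /nab2 !sum3 !DE !DH !sum3 !HC_sort; ring. Qed.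

Lemma nab2_dot a X Y i j :
  nab2 (fun i j => dot (X i) (Y j)) a i j =
  dot (nab2 X a i) (Y j) + dot (X i) (nab2 Y a j).
Proof. by rewrite /dot /nab2 !sum3 !DE !DH !sum3 !HC_sort; ring. Qed.

(** * The second Bianchi identity *)

(** The covariant derivative of the curvature as a tensor with one upper index. *)
Definition nab_rm a l k i j : A := D a (rm l k i j)
  + \sum_m gam l a m * rm m k i j - \sum_m gam m a k * rm l m i j
  - \sum_m gam m a i * rm l k m j - \sum_m gam m a j * rm l k i m.

Lemma bianchi2 a l k i j :
  nab_rm a l k i j + nab_rm i l k j a + nab_rm j l k a i = 0.
Proof.
rewrite /nab_rm /rm !sum3 !DE !(gamC _ i a) !(gamC _ j a) !(gamC _ j i).
by rewrite !(DC i a) !(DC j a) !(DC j i); ring.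
Qed.

(** The curvature with all indices lowered, as given by [rm_decomp]. *)
Definition rm_low l k i j : A :=
  g l i * P k j - g l j * P k i + g k j * P l i - g k i * P l j.

Lemma rm_lowE l k i j : rm_low l k i j = \sum_m g l m * rm m k i j.
Proof.
under eq_bigr do rewrite rm_decomp.
rewrite /rm_low -(lower_raise l (fun l => P l i)) -(lower_raise l (fun l => P l j)).
rewrite -(sum_delta i (g l)) -(sum_delta j (g l)) /P_mix !sum3.
by rewrite !(deltaC _ _ i) !(deltaC _ _ j); ring.
Qed.

Lemma nab4_rm_low a l k i j : nab4 rm_low a l k i j = \sum_m g l m * nab_rm a m k i j.
Proof.
have -> : rm_low = fun l k i j => \sum_m g l m * rm m k i j.
  by do 4!apply: funext => ?; exact: rm_lowE.
by rewrite /nab4 /nab_rm !sum3 !DE !Dg !sum3; ring.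
Qed.

Lemma nab4_rm_lowE a l k i j : nab4 rm_low a l k i j =
  g l i * nab2 P a k j - g l j * nab2 P a k i
  + g k j * nab2 P a l i - g k i * nab2 P a l j.
Proof. by rewrite /nab4 /nab2 /rm_low !sum3 !DE !Dg !sum3; ring. Qed.

Definition DP a i j := locked (nab2 P a i j).

Lemma DPE a i j : DP a i j = nab2 P a i j.
Proof. by rewrite /DP -lock. Qed.

Lemma DPC a i j : DP a i j = DP a j i.
Proof. by rewrite !DPE /nab2 (PC i j) !sum3 !(PC j) !(PC _ i); ring. Qed.

Lemma dJ a : D a J = trace (DP a).
Proof.
rewrite -trace_P D_trace.
by do 2!apply: eq_bigr => ? _; rewrite DPE.
Qed.

Definition divP j := trace (fun a b => DP a b j).

Lemma bianchi_DP a l k i j :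
  (g l i * DP a k j - g l j * DP a k i + g k j * DP a l i - g k i * DP a l j)
  + (g l j * DP i k a - g l a * DP i k j + g k a * DP i l j - g k j * DP i l a)
  + (g l a * DP j k i - g l i * DP j k a + g k i * DP j l a - g k a * DP j l i) = 0.
Proof.
rewrite !DPE -!nab4_rm_lowE !nab4_rm_low -!big_split big1 //= => m _.
by rewrite -!mulrDr bianchi2 mulr0.
Qed.

(** The trace of [bianchi_DP] over the first and the second index. *)
Lemma bianchi_trace k i j :
  g k j * (divP i - D i J) = g k i * (divP j - D j J).
Proof.
apply/eqP; rewrite -subr_eq0; apply/eqP.
have <- : trace (fun a l =>
 (g l i * DP a k j - g l j * DP a k i + g k j * DP a l i - g k i * DP a l j)
  + (g l j * DP i k a - g l a * DP i k j + g k a * DP i l j - g k j * DP i l a)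
  + (g l a * DP j k i - g l i * DP j k a + g k i * DP j l a - g k a * DP j l i)) = 0.
  by rewrite /trace; do 2!(rewrite big1 // => ? _); rewrite bianchi_DP mulr0.
symmetry; transitivity (dot (g i) (fun a => DP a k j) - dot (g j) (fun a => DP a k i)
  + g k j * divP i - g k i * divP j
  + dot (g j) (DP i k) - trace g * DP i k j + dot (g k) (DP i j)
  - g k j * trace (DP i)
  + trace g * DP j k i - dot (g i) (DP j k) + g k i * trace (DP j)
  - dot (g k) (DP j i)).
  rewrite /dot /divP /trace !sum3 !HC_sort.
  rewrite !(gC i o0) !(gC i o1) !(gC i o2) !(gC j o0) !(gC j o1) !(gC j o2).
  rewrite !gC_sort !(DPC _ _ j) !(DPC _ _ i)
    !(DPC _ o1 o0) !(DPC _ o2 o0) !(DPC _ o2 o1).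
  by ring.
rewrite !dot_g trace_g -!dJ !(DPC i j) !(DPC j i); ring.
Qed.

(** A further trace gives 3 x = x for the covector x = div P - dJ. *)
Lemma div_P i : divP i = D i J.
Proof.
apply/eqP; rewrite -subr_eq0; apply/eqP/double_eq0.
have e : trace g * (divP i - D i J) = dot (g i) (fun j => divP j - D j J).
  transitivity (trace (fun k j => g k j * (divP i - D i J))).
    by rewrite /trace !sum3; ring.
  transitivity (trace (fun k j => g k i * (divP j - D j J))).
    by do 2!apply: eq_bigr => ? _; rewrite bianchi_trace.
  by rewrite /dot /trace !sum3 !(gC _ i); ring.
by rewrite dot_g trace_g in e; apply: (@addIr A (divP i - D i J)); rewrite add0r -[RHS]e; ring.
Qed.

(** * Commuting covariant derivatives of the Schouten tensor *)

Definition P2 i j : A := dot (P i) (P j).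

Lemma P2C i j : P2 i j = P2 j i.
Proof. exact: dotC. Qed.

Definition normP2 : A := trace P2.

Definition hessJ a b : A := locked (nab1 (fun b => D b J) a b).

Definition DR a i j : A := locked (nab2 ric a i j).

Definition hessP a b i j : A := locked (nab3 DP a b i j).

Lemma hessJE a b : hessJ a b = nab1 (fun b => D b J) a b.
Proof. by rewrite /hessJ -lock. Qed.

Lemma DR_nab a i j : DR a i j = nab2 ric a i j.
Proof. by rewrite /DR -lock. Qed.

Lemma hessPE a b i j : hessP a b i j = nab3 DP a b i j.
Proof. by rewrite /hessP -lock. Qed.

Definition lapP i j : A := trace (fun a b => hessP a b i j).

Definition lapJ : A := trace hessJ.

Lemma hessJC a b : hessJ a b = hessJ b a.
Proof. by rewrite !hessJE /nab1 !sum3 !(gamC _ b a) (DC b a). Qed.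

Lemma DRE a i j : DR a i j = DP a i j + D a J * g i j.
Proof. by rewrite DR_nab DPE /nab2 !sum3 !ricE !DE !Dg !sum3; ring. Qed.

Lemma nab3_DR a b i j : nab3 DR a b i j = hessP a b i j + hessJ a b * g i j.
Proof. by rewrite hessPE hessJE /nab3 /nab1 !sum3 !DRE !DE !Dg !sum3; ring. Qed.

Lemma hessPC a b i j : hessP a b i j = hessP a b j i.
Proof. by rewrite !hessPE /nab3 !sum3 !(DPC _ i j) !(DPC _ _ i) !(DPC _ j); ring. Qed.

Lemma row_P k : (fun m => P m k) = P k.
Proof. by apply: funext => m; rewrite PC. Qed.

Lemma DP_funE : DP = nab2 P.
Proof. by do 3!apply: funext => ?; rewrite DPE. Qed.

(** The terms of the Ricci identity without a factor [g] cancel because [P] is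
    symmetric. *)
Lemma hessP_comm a b i j : hessP a b i j = hessP b a i j
  + (g i a * P2 b j - g i b * P2 a j + g j a * P2 b i - g j b * P2 a i).
Proof.
have := ricci_id2 P a b i j; rewrite -DP_funE -!hessPE.
rewrite (sum_rm i a b (fun m => P m j)) row_P (sum_rm j a b (P i)) => e.
by rewrite -[LHS](subrK (hessP b a i j)) e -!/(P2 _ _) (PC a j) (PC b j); ring.
Qed.

Lemma trace_hessP_div j i : trace (fun l m => hessP j l i m) = hessJ j i.
Proof.
rewrite hessJE; have -> : (fun b => D b J) = fun b => trace (fun p q => DP p q b).
  by apply: funext => b; rewrite -div_P.
by rewrite nab1_trace; do 2!apply: eq_bigr => ? _; rewrite hessPC hessPE.
Qed.

Lemma trace_hessP_comm i j : trace (fun l m => hessP l j i m) =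
  hessJ i j + 3%:R * P2 i j - normP2 * g i j.
Proof.
transitivity (trace (fun l m => hessP j l i m) + dot (g i) (P2 j)
  - g i j * normP2 + trace g * P2 i j - dot (g j) (P2 i)).
  under eq_trace => l m do rewrite hessP_comm.
  rewrite /normP2 /dot /trace !sum3 !(P2C j) !HC_sort.
  rewrite !gC_sort ?(P2C o1 o0) ?(P2C o2 o0) ?(P2C o2 o1) ?(P2C _ i).
  by rewrite ?(gC j o0) ?(gC j o1) ?(gC j o2) ?(gC i o0) ?(gC i o1) ?(gC i o2) ?(gC j i); ring.
by rewrite trace_hessP_div !dot_g trace_g (hessJC j) (P2C j); ring.
Qed.

Lemma trace_hessP_trace i j : trace (fun l m => hessP i j l m) = hessJ i j.
Proof.
rewrite hessJE; have -> : (fun b => D b J) = fun b => trace (fun p q => DP b p q).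
  by apply: funext => b; rewrite dJ.
rewrite /trace /nab1; under eq_bigr do under eq_bigr do rewrite hessPE.
by rewrite /nab3 !sum3 !DE !DH !sum3 !HC_sort; ring.
Qed.

(** The contractions of [P] with its covariant derivative to which both sides of
    the evolution equation reduce.  With raised indices written on top:
    - [PdP j k i] is P_j^l nabla_k P_il,
    - [PdP_in j k i] is P_j^l nabla_l P_ki,
    - [PdJ j] is P_j^l nabla_l J,
    - [trPdP k] is P^ab nabla_k P_ab, half the derivative of |P|^2,
    - [trPdP_in k] is P^ab nabla_a P_bk. *)
Definition PdP j k i : A := dot (P j) (DP k i).
Definition PdP_in j k i : A := dot (P j) (fun l => DP l k i).
Definition PdJ j : A := dot (P j) (fun l => D l J).
Definition trPdP k : A := trace (fun a b => PdP a k b).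
Definition trPdP_in k : A := trace (fun a b => PdP a b k).

Lemma PdP_inC j k i : PdP_in j k i = PdP_in j i k.
Proof. by do 2!apply: eq_bigr => ? _; rewrite DPC. Qed.

Lemma nab2_P2 k i j : nab2 P2 k i j = PdP j k i + PdP i k j.
Proof. by rewrite /P2 nab2_dot -DP_funE dotC. Qed.

Lemma D_normP2 k : D k normP2 = trPdP k + trPdP k.
Proof.
rewrite /normP2 D_trace.
transitivity (trace (fun a b => PdP b k a) + trPdP k); last by rewrite -traceC.
rewrite (eq_trace (nab2_P2 k)) /trPdP /trace !sum3; ring.
Qed.

Lemma div_P2 j : trace (fun a b => nab2 P2 a b j) = PdJ j + trPdP_in j.
Proof.
transitivity (trace (fun a b => PdP j a b) + trace (fun a b => PdP b a j)).
  under eq_trace => a b do rewrite nab2_P2.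
  by rewrite /trace !sum3; ring.
rewrite [trPdP_in j]traceC; congr (_ + _); rewrite /PdJ.
transitivity (dot (P j) (fun l => divP l)).
  rewrite /PdP /divP /dot /trace !sum3 !HC_sort; ring.
by do 2!apply: eq_bigr => ? _; rewrite div_P.
Qed.

(** The value of Delta nabla_k P_ij - nabla_k Delta P_ij.  The terms are in the
    order in which they arise in [trace_nab4_hessP]: first from exchanging the two
    inner derivatives, then from exchanging the two outer ones, slot by slot. *)
Definition lap_comm k i j : A :=
  PdP j i k + PdP k i j - g i k * (PdJ j + trPdP_in j)
  + PdP i j k + PdP k j i - g j k * (PdJ i + trPdP_in i)
  + PdP_in k i j + J * DP k i j
  - (P i k * D j J - PdP_in i k j + g i k * trPdP_in j - PdP k i j)
  - (P j k * D i J - PdP_in j k i + g j k * trPdP_in i - PdP k j i).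

Lemma hessP_funE : hessP = nab3 DP.
Proof. by do 4!apply: funext => ?; rewrite hessPE. Qed.

Lemma row_DP b j : (fun m => DP b m j) = DP b j.
Proof. by apply: funext => m; rewrite DPC. Qed.

(** Exchanging the two inner derivatives in nabla_a nabla_b nabla_k P_ij. *)
Lemma nab4_hessP_swap a b k i j : nab4 hessP a b k i j = nab4 hessP a k b i j +
  (g i b * nab2 P2 a k j - g i k * nab2 P2 a b j
   + g j b * nab2 P2 a k i - g j k * nab2 P2 a b i).
Proof.
have -> : nab4 hessP a b k i j = nab4 (fun b k i j => hessP k b i j +
    (g i b * P2 k j - g i k * P2 b j + g j b * P2 k i - g j k * P2 b i)) a b k i j.
  by congr (nab4 _ _ _ _ _ _); do 4!apply: funext => ?; rewrite hessP_comm.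
by rewrite /nab4 /nab2 !sum3 !DE !Dg !sum3; ring.
Qed.

(** Exchanging the two outer derivatives in nabla_a nabla_k nabla_b P_ij. *)
Lemma nab4_hessP_comm a b k i j : nab4 hessP a k b i j = nab4 hessP k a b i j
  - (P b k * DP a i j - P b a * DP k i j
     + g b k * dot (P a) (fun m => DP m i j) - g b a * dot (P k) (fun m => DP m i j))
  - (P i k * DP b a j - P i a * DP b k j
     + g i k * dot (P a) (DP b j) - g i a * dot (P k) (DP b j))
  - (P j k * DP b i a - P j a * DP b i k
     + g j k * dot (P a) (DP b i) - g j a * dot (P k) (DP b i)).
Proof.
have := ricci_id3 DP a k b i j; rewrite -hessP_funE.
rewrite (sum_rm b a k (fun m => DP m i j)) (sum_rm i a k (fun m => DP b m j)).
rewrite (sum_rm j a k (DP b i)) row_DP => e.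
by rewrite -[LHS](subrK (nab4 hessP k a b i j)) e; ring.
Qed.

Lemma trace_nab4_hessP k i j :
  trace (fun a b => nab4 hessP a b k i j) = nab2 lapP k i j + lap_comm k i j.
Proof.
transitivity (trace (fun a b => nab4 hessP k a b i j)
  + dot (g i) (fun a => nab2 P2 a k j) - g i k * trace (fun a b => nab2 P2 a b j)
  + dot (g j) (fun a => nab2 P2 a k i) - g j k * trace (fun a b => nab2 P2 a b i)
  - (dot (P k) (fun a => DP a i j) - trace P * DP k i j
     + dot (g k) (fun a => PdP_in a i j) - trace g * PdP_in k i j)
  - (P i k * divP j - dot (P i) (fun b => DP b k j) + g i k * trPdP_in j
     - dot (g i) (fun b => PdP k b j))
  - (P j k * divP i - dot (P j) (fun b => DP b k i) + g j k * trPdP_in i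
     - dot (g j) (fun b => PdP k b i))); last first.
  rewrite /lapP nab2_trace !dot_g !div_P2 !nab2_P2 trace_g trace_P !div_P /lap_comm.
  rewrite -/(PdP_in k i j) -/(PdP_in i k j) -/(PdP_in j k i).
  by ring.
under eq_trace => a b.
  rewrite nab4_hessP_swap nab4_hessP_comm.
  rewrite -!/(PdP_in _ _ _) -!/(PdP _ _ _).
  over.
rewrite /dot /divP /trPdP_in /trace !sum3.
rewrite !HC_sort !gC_sort.
rewrite ?(gC _ i) ?(gC _ j) ?(gC _ k) ?(PC _ k) ?(PC o1 o0) ?(PC o2 o0) ?(PC o2 o1).
rewrite ?(DPC _ _ i) ?(DPC _ _ j).
by ring.
Qed.

(** The Cotton tensor in terms of the Schouten tensor; [cotton_tensorE] relates
    it to the usual expression in Ricci and scalar curvature. *)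
Definition cotton_tensor i j k : A := DP k i j - DP j i k.

Lemma lap_cotton i j k :
  trace (fun a b => nab4 (nab3 cotton_tensor) a b i j k) =
  nab2 lapP k i j - nab2 lapP j i k + lap_comm k i j - lap_comm j i k.
Proof.
have e : nab3 cotton_tensor = fun b i j k => hessP b k i j - hessP b j i k.
  do 4!apply: funext => ?; rewrite !hessPE /nab3 /cotton_tensor !sum3 !DE; ring.
transitivity (trace (fun a b => nab4 hessP a b k i j) - trace (fun a b => nab4 hessP a b j i k)).
  rewrite e; under eq_trace => a b.
    have -> : nab4 (fun b i j k => hessP b k i j - hessP b j i k) a b i j k =
        nab4 hessP a b k i j - nab4 hessP a b j i k.
      by rewrite /nab4 !sum3 !DE; ring.
    over.
  by rewrite /trace !sum3; ring.
by rewrite !trace_nab4_hessP; ring.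
Qed.

(** * Evolution under the Ricci flow *)

Section Flow.
Variable Dt : A -> A.
Hypothesis Dt_add : forall x y, Dt (x + y) = Dt x + Dt y.
Hypothesis Dt_mul : forall x y, Dt (x * y) = Dt x * y + x * Dt y.
Hypothesis DtD : forall i x, Dt (D i x) = D i (Dt x).
Hypothesis flow : forall i j, Dt (g i j) = - 2%:R * ric i j.

Lemma Dt0 : Dt 0 = 0.
Proof. by apply: (@addIr A (Dt 0)); rewrite -Dt_add !add0r. Qed.

Lemma Dt_opp x : Dt (- x) = - Dt x.
Proof. by apply/eqP; rewrite -addr_eq0 -Dt_add addNr Dt0. Qed.

Lemma Dt1 : Dt 1 = 0.
Proof.
by apply: (@addIr A (Dt 1)); rewrite add0r -[in RHS](mulr1 1) Dt_mul mulr1 mul1r.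
Qed.

Lemma Dt_nat n : Dt n%:R = 0.
Proof. by elim: n => [|n IH]; rewrite ?Dt0 // mulrS Dt_add Dt1 IH addr0. Qed.

Lemma Dt_half : Dt half = 0.
Proof. by apply: double_eq0; rewrite -Dt_add half2 Dt1. Qed.

Definition DtE := (Dt_add, Dt_opp, Dt_mul, Dt_half, Dt_nat, Dt1, Dt0).

Definition ric_up i j : A := \sum_a \sum_b H i a * H j b * ric a b.

Lemma Dt_H i j : Dt (H i j) = 2%:R * ric_up i j.
Proof.
move: j; apply: lower_inj => j.
have e1 : \sum_m Dt (H i m) * g m j + \sum_m H i m * Dt (g m j) = 0.
  have := congr1 Dt (Hg i j); rewrite /delta Dt_nat => e; rewrite -[RHS]e.
  by rewrite !sum3 !DtE; ring.
have e2 : \sum_m g j m * ric_up i m = \sum_a H i a * ric a j.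
  rewrite -(lower_raise j (fun j => \sum_a H i a * ric a j)) /ric_up.
  by rewrite !sum3; ring.
transitivity (\sum_m Dt (H i m) * g m j).
  by apply: eq_bigr => m _; rewrite mulrC gC.
apply: (@addIr A (\sum_m H i m * Dt (g m j))); rewrite e1.
transitivity (2%:R * (\sum_m g j m * ric_up i m) - 2%:R * (\sum_a H i a * ric a j)).
  by rewrite e2 subrr.
by under [X in _ = _ + X]eq_bigr do rewrite flow; rewrite !sum3; ring.
Qed.

(** The variation of the connection is a tensor; this is minus that tensor with
    its upper index lowered. *)
Definition var_gam k i j : A := DR i j k + DR j i k - DR k i j.

(** Differentiating [gam_lower] gives the first variation of the
    connection.  The terms in which the Christoffel symbols themselves occur turn
    the partial derivatives of the Ricci tensor into covariant ones. *)
Lemma Dt_gam l i j : Dt (gam l i j) = - \sum_k H l k * var_gam k i j.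
Proof.
move: l; apply: lower_inj => k.
transitivity (- var_gam k i j); last first.
  by rewrite -[in LHS](lower_raise k (fun k => var_gam k i j)) !sum3; ring.
have e := congr1 Dt (gam_lower k i j).
have {}e : \sum_m Dt (g k m) * gam m i j + \sum_m g k m * Dt (gam m i j) =
    - (D i (ric j k) + D j (ric i k) - D k (ric i j)).
  rewrite -[RHS]halfM; transitivity (Dt (\sum_m g k m * gam m i j)).
    by rewrite !sum3 !DtE; ring.
  by rewrite e !DtE !DtD !flow !DE; ring.
apply: (@addrI A (\sum_m Dt (g k m) * gam m i j)); rewrite e.
under eq_bigr do rewrite flow.
rewrite /var_gam !DR_nab /nab2 !sum3 (gamC _ j i) !(gamC _ j i) !(gamC _ k i) !(gamC _ k j).
rewrite !(ricC _ o0) !(ricC _ o1) !(ricC _ o2) ?(ricC k i) ?(ricC k j) ?(ricC j i).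
by ring.
Qed.

(** The variation of the curvature is the antisymmetrised covariant derivative of
    the variation of the connection. *)
Lemma Dt_rm l k i j : Dt (rm l k i j) =
  - \sum_m H l m * (nab3 var_gam i m j k - nab3 var_gam j m i k).
Proof.
rewrite /rm /nab3 !sum3 !DtE !DtD !Dt_gam !sum3 !DE !DH !sum3 (gamC _ j i) !(gamC _ j i).
rewrite !HC_sort.
by ring.
Qed.

Lemma nab3_var_gam i m j k :
  nab3 var_gam i m j k = nab3 DR i j k m + nab3 DR i k j m - nab3 DR i m j k.
Proof. by rewrite /nab3 /var_gam !sum3 !DE; ring. Qed.

(** The trace of [Dt_rm].  By [trace_hessP_comm] the Hessians of [J] that arise
    cancel, which leaves the Laplacian and a quadratic reaction term. *)
Lemma Dt_ric i j : Dt (ric i j) =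
  lapP i j + lapJ * g i j - 6%:R * P2 i j + 2%:R * normP2 * g i j.
Proof.
have -> : Dt (ric i j) = \sum_l Dt (rm l i l j) by rewrite /ric !sum3 !DtE.
transitivity (trace (fun l m => hessP l m j i) + lapJ * g i j
   - trace (fun l m => hessP l j i m) - trace (fun l m => hessP l i j m)
   + trace (fun l m => hessP j i l m) - dot (g i) (hessJ j) - dot (g j) (hessJ i)
   + hessJ j i * trace g); last first.
  rewrite !trace_hessP_comm trace_hessP_trace !dot_g trace_g (hessJC j) (P2C j) (gC j).
  have -> : lapP i j = trace (fun l m => hessP l m j i) by apply: eq_trace => *; exact: hessPC.
  by ring.
under eq_bigr do rewrite Dt_rm.
under eq_bigr do under eq_bigr do rewrite !nab3_var_gam !nab3_DR.
rewrite /lapJ /trace /dot !sum3.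
rewrite !HC_sort !(gC j i) !(hessJC j i).
rewrite !gC_sort.
rewrite ?(gC j o0) ?(gC j o1) ?(gC j o2) ?(gC i o0) ?(gC i o1) ?(gC i o2).
rewrite !(hessJC o1 o0) !(hessJC o2 o0) !(hessJC o2 o1).
rewrite ?(hessJC j o0) ?(hessJC j o1) ?(hessJC j o2) ?(hessJC i o0) ?(hessJC i o1) ?(hessJC i o2).
rewrite ?(hessPC _ _ _ i) ?(hessPC _ _ _ j).
by ring.
Qed.

Lemma trace_lapP : trace lapP = lapJ.
Proof.
rewrite /lapJ -(eq_trace trace_hessP_trace) /lapP /trace !sum3 /=; ring.
Qed.

Lemma sum_ric_up T : \sum_i \sum_j ric_up i j * T i j =
  trace (fun a i => dot (ric a) (T i)).
Proof.
rewrite traceC /ric_up /trace /dot.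
apply: eq_bigr => i _; rewrite !sum3 !HC_sort; ring.
Qed.

Lemma dot_ric a X : dot (ric a) X = dot (P a) X + J * X a.
Proof. by rewrite -[in RHS](dot_g a X) /dot !sum3 !ricE; ring. Qed.

Definition ric_norm2 : A := \sum_i \sum_j ric_up i j * ric i j.

Lemma ric_norm2E : ric_norm2 = normP2 + 5%:R * (J * J).
Proof.
rewrite /ric_norm2 sum_ric_up.
transitivity (normP2 + (J + J) * trace P + J * J * trace g).
  under eq_trace => a b do rewrite dot_ric dotC dot_ric dotC -/(P2 _ _) !ricE (PC b a) (gC b a).
  by rewrite /normP2 /trace !sum3; ring.
by rewrite trace_P trace_g; ring.
Qed.

Lemma Dt_scal : Dt scal = 4%:R * lapJ + 2%:R * normP2 + 10%:R * (J * J).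
Proof.
transitivity (2%:R * ric_norm2 + trace (fun i j => Dt (ric i j))).
  by rewrite /ric_norm2 /scal /trace !sum3 !DtE !Dt_H; ring.
transitivity (2%:R * ric_norm2 + (trace lapP + lapJ * trace g - 6%:R * trace P2
   + 2%:R * normP2 * trace g)).
  by congr (_ + _); under eq_trace => a b do rewrite Dt_ric; rewrite /trace !sum3; ring.
by rewrite trace_lapP trace_g ric_norm2E -/normP2; ring.
Qed.

Lemma Dt_J : Dt J = lapJ + half * (normP2 + 5%:R * (J * J)).
Proof.
have e : J = half * (half * scal) by rewrite /J -lock mulrA.
rewrite {1}e !DtE Dt_scal.
have -> : 4%:R * lapJ + 2%:R * normP2 + 10%:R * (J * J) =
    (lapJ + lapJ + (normP2 + 5%:R * (J * J)))
    + (lapJ + lapJ + (normP2 + 5%:R * (J * J))) by ring.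
by rewrite halfM !mul0r !add0r mulrDr halfM.
Qed.

Lemma Dt_P i j : Dt (P i j) = lapP i j - 6%:R * P2 i j + 2%:R * (J * P i j)
  + (2%:R * normP2 + 2%:R * (J * J) - half * (normP2 + 5%:R * (J * J))) * g i j.
Proof. by rewrite /P -lock !DtE Dt_ric Dt_J flow !ricE -/(P _ _); ring. Qed.

Lemma sum_Dt_gam i j k : \sum_m Dt (gam m k i) * P m j =
  - (PdP j k i + PdP j i k - PdP_in j k i + D k J * P i j + D i J * P j k - g k i * PdJ j).
Proof.
have -> : \sum_m Dt (gam m k i) * P m j = - dot (fun l => var_gam l k i) (P j).
  rewrite dotC /dot; under eq_bigr do rewrite Dt_gam.
  rewrite !sum3 !(PC _ j); ring.
have <- : dot (g i) (P j) = P i j by rewrite dot_g PC.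
have <- : dot (g k) (P j) = P j k by rewrite dot_g.
rewrite /PdP /PdP_in /PdJ /dot /var_gam !sum3 !DRE !HC_sort.
by ring.
Qed.

(** Time differentiation does not commute with nabla because the connection
    moves. *)
Lemma Dt_nab2_P k i j : Dt (nab2 P k i j) = nab2 (fun i j => Dt (P i j)) k i j
  - \sum_m Dt (gam m k i) * P m j - \sum_m Dt (gam m k j) * P m i.
Proof. by rewrite /nab2 !sum3 !DtE !DtD !(PC _ i); ring. Qed.

Lemma Dt_DP k i j : Dt (DP k i j) = nab2 lapP k i j
  - 6%:R * (PdP j k i + PdP i k j) + 2%:R * (D k J * P i j + J * DP k i j)
  + (3%:R * trPdP k - J * D k J) * g i j
  - \sum_m Dt (gam m k i) * P m j - \sum_m Dt (gam m k j) * P m i.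
Proof.
rewrite !DPE Dt_nab2_P; congr (_ - _ - _); rewrite -nab2_P2.
pose c := 2%:R * normP2 + 2%:R * (J * J) - half * (normP2 + 5%:R * (J * J)).
have <- : D k c = 3%:R * trPdP k - J * D k J.
  have -> : 3%:R * trPdP k - J * D k J =
      4%:R * (trPdP k + J * D k J) - (trPdP k + 5%:R * (J * D k J)) by ring.
  rewrite -[X in _ = _ - X]halfM /c !DE D_normP2; ring.
have -> : (fun i j => Dt (P i j)) =
    fun i j => lapP i j - 6%:R * P2 i j + 2%:R * (J * P i j) + c * g i j.
  by do 2!apply: funext => ?; rewrite Dt_P.
move: c => c; rewrite /nab2 !sum3 !DE !Dg !sum3; ring.
Qed.

Local Notation C := cotton_tensor.

Lemma Dt_cotton i j k : Dt (C i j k) =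
   nab2 lapP k i j - nab2 lapP j i k
   - 6%:R * (PdP j k i + PdP i k j) + 6%:R * (PdP k j i + PdP i j k)
   + 2%:R * (D k J * P i j + J * DP k i j) - 2%:R * (D j J * P i k + J * DP j i k)
   + (3%:R * trPdP k - J * D k J) * g i j - (3%:R * trPdP j - J * D j J) * g i k
   - \sum_m Dt (gam m k i) * P m j + \sum_m Dt (gam m j i) * P m k.
Proof.
by rewrite /C !DtE !Dt_DP !sum3 !(gamC _ k j); ring.
Qed.

(** The usual definition of the Cotton tensor; [half * half] is 1/4. *)
Lemma cotton_tensorE i j k : cotton_tensor i j k =
  nab2 ric k i j - nab2 ric j i k
  - half * half * (D k scal * g i j - D j scal * g i k).
Proof.
have dS a : half * half * D a scal = D a J.
  by rewrite scalJ !DE -mulrA !halfM.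
rewrite mulrBr !mulrA !dS -!DR_nab !DRE /cotton_tensor; ring.
Qed.

Lemma sum_ric j X : \sum_p \sum_q H p q * ric p j * X q = dot (P j) X + J * X j.
Proof. by rewrite -dot_ric /dot !sum3 !(ricC j). Qed.

Lemma dot_P_cotton_sym i j k : dot (P j) (fun q => C k q i + C q k i) =
  2%:R * PdP j i k - PdP_in j k i - PdP j k i.
Proof. by rewrite /PdP /PdP_in /dot /C !sum3 !(DPC _ k) !(DPC _ _ i); ring. Qed.

Lemma dot_P_cotton i j k : dot (P i) (fun q => C q k j) = PdP i j k - PdP i k j.
Proof. by rewrite /PdP /PdP_in /dot /C !sum3 !(DPC _ _ k) !(DPC _ _ j); ring. Qed.

Lemma dot_P_nab_ric i j k : dot (P k) (fun q => nab2 ric j q i) = PdP k j i + D j J * P k i.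
Proof.
have <- : dot (g i) (P k) = P k i by rewrite dot_g.
rewrite dotC; rewrite /PdP /dot !sum3 -!DR_nab !DRE !(DPC _ _ i) !(gC _ i).
rewrite !HC_sort; ring.
Qed.

(** Equivalent to div P = dJ. *)
Lemma trace_cotton j : trace (fun q l => C q j l) = 0.
Proof.
transitivity (divP j - trace (DP j)); last by rewrite -dJ div_P subrr.
rewrite /divP /trace /C !sum3 !(DPC _ _ j) !HC_sort; ring.
Qed.

Lemma sum_ric_up_cotton j : \sum_q \sum_l ric_up q l * C q j l = trPdP_in j - trPdP j.
Proof.
rewrite sum_ric_up; under eq_trace => a b do rewrite dot_ric.
transitivity (trPdP_in j - trPdP j + J * trace (fun q l => C q j l)); last first.
  by rewrite trace_cotton; ring.
rewrite /trPdP_in /trPdP /trace /PdP /dot /C !sum3.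
rewrite  !HC_sort !(DPC _ _ j) !(PC o1 o0) !(PC o2 o0) !(PC o2 o1).
ring.
Qed.

(** After the substitution of the lemmas above both sides are polynomials in [P],
    [g], [J], their derivatives and the contractions [PdP], ..., [trPdP_in]; the
    two copies of nabla Delta P have cancelled. *)
Theorem cotton_evolution_alg i j k :
  Dt (C i j k) - trace (fun a b => nab4 (nab3 C) a b i j k)
   = \sum_p \sum_q H p q * ric p j * (C k q i + C q k i)
     + 5%:R * (\sum_p \sum_q H p q * ric i p * C q k j)
     + \sum_p \sum_q H p q * ric p k * (C j i q + C q i j)
     + 2%:R * scal * C i j k
     + 2%:R * (\sum_q \sum_l ric_up q l * C q j l) * g i k
     - 2%:R * (\sum_q \sum_l ric_up q l * C q k l) * g i j
     + half * D k ric_norm2 * g i j - half * D j ric_norm2 * g i k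
     + scal * half * D j scal * g i k - scal * half * D k scal * g i j
     + 2%:R * (\sum_p \sum_q H p q * ric p k * nab2 ric j q i)
     - 2%:R * (\sum_p \sum_q H p q * ric p j * nab2 ric k q i)
     + ric i j * D k scal - ric i k * D j scal.
Proof.
rewrite lap_cotton Dt_cotton !sum_Dt_gam !sum_ric_up_cotton !sum_ric.
under [X in 5%:R * X]eq_bigr do under eq_bigr do rewrite (ricC i).
rewrite sum_ric !dot_P_cotton_sym dot_P_cotton !dot_P_nab_ric.
have -> : dot (P k) (fun q => C j i q + C q i j) =
    - (2%:R * PdP k i j - PdP_in k j i - PdP k j i).
  by rewrite -(dot_P_cotton_sym i k j) /dot /C !sum3; ring.
have eN a : half * D a ric_norm2 = trPdP a + 5%:R * (J * D a J).
  by rewrite ric_norm2E !DE D_normP2 -[RHS]halfM; ring.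
have dS a : D a scal = 4%:R * D a J by rewrite scalJ !DE; ring.
rewrite !eN !dS -!DR_nab !DRE !ricE !(mulrC scal half) half_scalJ scalJ.
rewrite /lap_comm /C.
rewrite !(gC _ i) !(PC _ i) !(gC k j) !(PC k j) !(PdP_inC k i) !(PdP_inC j i) !(PdP_inC _ k j)
  !(DPC i k) !(DPC j k) !(DPC k j).
ring.
Qed.

End Flow.

End Riemannian.

End DiffAlg.

(** * One-sided derivatives in time *)

Section TimeDerivative.
Context {R : realType}.
Implicit Types (K : set R) (f h : R -> R) (t l m : R).

Definition has_time_derive K f t l : Prop :=
  time_quotient f t @ within K t^' --> l.

(** Limits along [within K t^'] are unique: a nondegenerate interval accumulates
    at each of its points, its ends included. *)
Lemma interval_limit_point K t :
  is_interval K -> K° !=set0 -> K t -> ProperFilter (within K t^').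
Proof.
move=> K_int [c /nbhs_ballP[e /= e0 ceK]] Kt.
apply: Build_ProperFilter_ex => A.
rewrite /within /= => /nbhs_ballP[d /= d0 dA].
have [b Kb tb] : exists2 b, K b & t != b.
  have [->|ne_tc] := eqVneq t c.
    exists (c + e / 2).
      by apply: ceK; rewrite /ball /= opprD addrA subrr add0r normrN gtr0_norm; lra.
    by rewrite -subr_eq0 opprD addrA subrr add0r oppr_eq0; apply/lt0r_neq0; lra.
  by exists c => //; apply: ceK; exact: ballxx.
(* The point at a fraction z of the way from t to b lies in K and within d of t. *)
pose z := Num.min (d / 2 / `|b - t|) 1.
have bt0 : 0 < `|b - t| by rewrite normr_gt0 subr_eq0 eq_sym.
have z0 : 0 < z by rewrite lt_min ltr01 divr_gt0 // divr_gt0.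
have z1 : z <= 1 by rewrite ge_min lexx orbT.
exists (t + z * (b - t)); apply: dA.
- rewrite /ball /= opprD addrA subrr add0r normrN normrM gtr0_norm //.
  have : z * `|b - t| <= d / 2.
    by rewrite -ler_pdivlMr // ge_min lexx.
  by move: d0 => /= d0; lra.
- rewrite -subr_eq0 addrAC subrr add0r.
  by apply: mulf_neq0; [exact: lt0r_neq0|rewrite subr_eq0 eq_sym].
- have [le_tb|/ltW le_bt] := leP t b.
    apply: (K_int t b) => //; apply/andP; split; nra.
  apply: (K_int b t) => //; apply/andP; split; nra.
Qed.

Section Rules.
Variables (K : set R) (t : R).
Hypothesis K_int : is_interval K.
Hypothesis K_nondeg : K° !=set0.
Hypothesis Kt : K t.

Let F := within K t^'.
Let properF : ProperFilter F := interval_limit_point K_int K_nondeg Kt.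
#[local] Existing Instance properF.

Lemma has_time_deriveP f l :
  has_time_derive K f t l -> time_derivable K f t /\ time_derive K f t = l.
Proof.
move=> fl; split; first by apply/cvg_ex; exists l.
exact: cvg_lim fl.
Qed.

Lemma near_within_neq : \forall s \near F, K s /\ s != t.
Proof. by rewrite /F near_withinE; near=> s => Ks; split=> //; near: s; exact: nbhs_dnbhs_neq.
Unshelve. all: by end_near. Qed.

Lemma cvg_within_id : (id : R -> R) @ F --> t.
Proof. by apply: cvg_within_filter; exact: nbhs_dnbhs. Qed.

Lemma has_time_derive_continuous f l :
  has_time_derive K f t l -> f @ F --> f t.
Proof.
move=> fl.
have h : (fun s => f t + (s - t) * time_quotient f t s) @ F --> f t + (t - t) * l.
  apply: cvgD; first exact: cvg_cst.
  apply: cvgM => //; apply: cvgB; [exact: cvg_within_id|exact: cvg_cst].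
rewrite subrr mul0r addr0 in h.
apply: cvg_trans h; apply: near_eq_cvg.
apply: filterS near_within_neq => s [_ st].
by rewrite /time_quotient mulrA mulfV ?subr_eq0 // mul1r addrC subrK.
Qed.

Lemma eq_has_time_derive f h l : (forall s, K s -> f s = h s) ->
  has_time_derive K f t l -> has_time_derive K h t l.
Proof.
move=> efh; apply: cvg_trans; apply: near_eq_cvg.
by apply: filterS near_within_neq => s [Ks _]; rewrite /time_quotient !efh.
Qed.

Lemma has_time_derive_cst c : has_time_derive K (fun=> c) t 0.
Proof.
rewrite /has_time_derive (_ : time_quotient _ _ = fun=> 0); first exact: cvg_cst.
by apply: funext => s; rewrite /time_quotient subrr mulr0.
Qed.

Lemma has_time_deriveD f h l m : has_time_derive K f t l ->
  has_time_derive K h t m -> has_time_derive K (fun s => f s + h s) t (l + m).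
Proof.
move=> fl hm; rewrite /has_time_derive.
rewrite (_ : time_quotient _ _ = time_quotient f t \+ time_quotient h t).
  exact: cvgD.
by apply: funext => s; rewrite /time_quotient /=; ring.
Qed.

Lemma has_time_deriveM f h l m : has_time_derive K f t l ->
  has_time_derive K h t m ->
  has_time_derive K (fun s => f s * h s) t (l * h t + f t * m).
Proof.
move=> fl hm; rewrite /has_time_derive.
rewrite (_ : time_quotient _ _ =
    (fun s => time_quotient f t s * h s + f t * time_quotient h t s)).
  apply: cvgD; apply: cvgM => //; [exact: has_time_derive_continuous hm|exact: cvg_cst].
by apply: funext => s; rewrite /time_quotient /=; ring.
Qed.

Lemma has_time_deriveV f l : (forall s, K s -> f s != 0) ->
  has_time_derive K f t l ->
  has_time_derive K (fun s => (f s)^-1) t (- ((f t)^-1 * (f t)^-1 * l)).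
Proof.
move=> f0 fl.
have h : (fun s => - ((f s)^-1 * (f t)^-1 * time_quotient f t s)) @ F -->
    - ((f t)^-1 * (f t)^-1 * l).
  apply: cvgN; apply: cvgM => //; apply: cvgM; last exact: cvg_cst.
  by apply: cvgV; [exact: f0|exact: has_time_derive_continuous fl].
apply: cvg_trans h; apply: near_eq_cvg.
apply: filterS near_within_neq => s [Ks st].
rewrite /time_quotient; have fs := f0 _ Ks; have ft := f0 _ Kt.
by field; rewrite fs ft subr_eq0.
Qed.

End Rules.

(** At an interior point the restriction to [K] is immaterial. *)
Lemma is_derive_time K f t l : nbhs t K ->
  is_derive t (1 : R) f l <-> has_time_derive K f t l.
Proof.
move=> Kt.
have e : within K t^' = t^'.
  rewrite eqEsubset; split => A; rewrite /within /=; last by apply: filterS.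
  move=> h; have hK : t^' K by exact: nbhs_dnbhs.
  by apply: filterS2 hK h => s Ks /(_ Ks).
have e2 : (fun s : R => s^-1 *: ((f \o shift t) (s *: 1) - f t)) @ 0^' =
   time_quotient f t @ t^'.
  have -> : t^' = (+%R^~ t) @ 0^'.
    apply: funext => A; rewrite propeqE.
    have sh := near_shift (0 : R) t (fun y => y != t -> A y).
    have zt (z : R) : (z + t != t) = (z != 0).
      by rewrite -[X in _ != X]add0r (inj_eq (addIr _)).
    split=> hA.
      have : \forall y \near t, y != t -> A y by exact: hA.
      by rewrite sh; apply: filterS => z /=; rewrite subr0 zt.
    suff : \forall y \near t, y != t -> A y by [].
    have hA' : \forall z \near (0 : R), z != 0 -> A (z + t) by exact: hA.
    by rewrite sh; apply: filterS hA' => z /=; rewrite subr0 zt.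
  rewrite -fmap_comp.
  rewrite (_ : (fun s : R => _) = time_quotient f t \o (+%R^~ t)) //.
  by apply: funext => s /=; rewrite /time_quotient [_ *: 1]mulr1 addrK.
rewrite /has_time_derive e -e2; split.
  by move=> [d <-]; exact: d.
move=> fl; apply: DeriveDef; first by apply/cvg_ex; exists l.
exact: cvg_lim fl.
Qed.

End TimeDerivative.

(** * Mixed partial derivatives *)

Section Mixed.
Context {R : realType}.
Implicit Types (K : set R) (f : R -> R) (t l m : R).

Lemma interval_nbhs K (a b s : R) : is_interval K -> K a -> K b ->
  s \in `]a, b[%R -> nbhs s K.
Proof.
move=> K_int Ka Kb sab.
have : nbhs s `]a, b[%classic by apply: open_nbhs_nbhs; split => //; exact: interval_open.
apply: filterS => y /=; rewrite in_itv /= => /andP[ay yb].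
by apply: (K_int a b) => //; rewrite (ltW ay) (ltW yb).
Qed.

(** The mean value theorem needs the derivative only between the two points, and
    those are interior to the interval even if one of the two is an end of it. *)
Lemma time_MVT_lt K f (df : R -> R) (a b : R) :
  is_interval K -> K° !=set0 -> K a -> K b -> a < b ->
  (forall s, a <= s <= b -> has_time_derive K f s (df s)) ->
  exists2 c, a <= c <= b & f b - f a = df c * (b - a).
Proof.
move=> K_int K_nd Ka Kb ab fd.
have Kab s : a <= s <= b -> K s by move=> sab; exact: (K_int a b).
have [c cab e] : exists2 c, c \in `]a, b[%R & f b - f a = df c * (b - a).
  apply: MVT => // [s sab|].
    apply/(is_derive_time _ _ (interval_nbhs K_int Ka Kb sab)).
    by apply: fd; move: sab; rewrite in_itv /= => /andP[/ltW -> /ltW ->].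
  apply/subspace_continuousP => s /= sab B nB.
  rewrite in_itv /= in sab.
  have h := has_time_derive_continuous (fd _ sab) nB.
  have : \forall y \near s, y != s -> K y -> B (f y) by exact: h.
  apply: filterS => y hy; rewrite /= in_itv /= => yab.
  have [->|ys] := eqVneq y s; first exact: nbhs_singleton.
  by apply: hy => //; exact: Kab.
exists c => //; move: cab.
by rewrite in_itv /= => /andP[/ltW -> /ltW ->].
Qed.

Lemma time_MVT K f (df : R -> R) (a b : R) :
  is_interval K -> K° !=set0 -> K a -> K b ->
  (forall s, K s -> `|s - a| <= `|b - a| -> has_time_derive K f s (df s)) ->
  exists c, [/\ K c, `|c - a| <= `|b - a| & f b - f a = df c * (b - a)].
Proof.
move=> K_int K_nd Ka Kb fd.
have [ab|ba|->] := ltgtP a b.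
- have h s : a <= s <= b -> K s /\ `|s - a| <= `|b - a|.
    move=> sab; split; first exact: (K_int a b).
    by case/andP: sab => as_ sb; rewrite !ger0_norm ?subr_ge0 //; lra.
  have [|c cab e] := time_MVT_lt (f := f) (df := df) K_int K_nd Ka Kb ab.
    by move=> s sab; have [Ks ?] := h _ sab; exact: fd.
  by exists c; have [? ?] := h _ cab; split.
- have h s : b <= s <= a -> K s /\ `|s - a| <= `|b - a|.
    move=> sab; split; first exact: (K_int b a).
    by case/andP: sab => as_ sb; rewrite !ler0_norm ?subr_le0 //; lra.
  have [|c cab e] := time_MVT_lt (f := f) (df := df) K_int K_nd Kb Ka ba.
    by move=> s sab; have [Ks ?] := h _ sab; exact: fd.
  exists c; have [? ?] := h _ cab; split => //; apply: oppr_inj.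
  by rewrite opprB e; ring.
- by exists b; split => //; rewrite !subrr mulr0.
Qed.

(** Here [F1] is the time derivative of [F], [F12] the derivative of [F1] in the
    second variable, and [F2] the derivative of [F] in the second variable at 0.
    The second difference of [F] over a rectangle with corners (t, 0) and (s, h)
    equals h (s - t) times a value of [F12] inside the rectangle, by the mean
    value theorem in each direction.  Letting h tend to 0 shows that the
    difference quotient of [F2] is a limit of such values, hence close to
    F12 (t, 0) when s is close to t.  Nothing is assumed about the time
    derivative of [F2], whose existence is part of the conclusion. *)
Lemma mixed_time_derive K t (F F1 F12 : R -> R -> R) (F2 : R -> R) (r : R) :
  is_interval K -> K° !=set0 -> K t -> 0 < r ->
  (forall s h, K s -> `|s - t| < r -> `|h| < r ->
     has_time_derive K (F^~ h) s (F1 s h)) ->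
  (forall s h, K s -> `|s - t| < r -> `|h| < r ->
     is_derive h (1 : R) (F1 s) (F12 s h)) ->
  (forall s, K s -> `|s - t| < r -> is_derive (0 : R) (1 : R) (F s) (F2 s)) ->
  (forall e, 0 < e -> exists2 d, 0 < d & forall s h, K s ->
     `|s - t| < d -> `|h| < d -> `|F12 t 0 - F12 s h| <= e) ->
  has_time_derive K F2 t (F12 t 0).
Proof.
move=> K_int K_nd Kt r0 dF1 dF12 dF2 cF12.
have properF := interval_limit_point K_int K_nd Kt.
apply/cvgrPdist_le => e /cF12[d d0 hd].
pose d' := Num.min d r.
have d'0 : 0 < d' by rewrite lt_min d0.
have [d'd d'r] : d' <= d /\ d' <= r by rewrite !ge_min !lexx orbT.
have nt : \forall s \near within K t^', `|s - t| < d'.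
  rewrite near_withinE; near=> s => _; near: s; apply: nbhs_dnbhs.
  by apply/nbhs_ballP; exists d' => // y; rewrite /ball /= distrC.
apply: filterS2 nt (near_within_neq K t) => s sd [Ks st].
have tt0 : `|t - t| < r by rewrite subrr normr0.
have T_int : is_interval (setT : set R) by [].
have T_nd : (setT : set R)° !=set0 by exists 0; exact: filterT.
pose phi h := F s h - F t h.
have dphi : has_time_derive setT phi 0 (F2 s - F2 t).
  apply/(is_derive_time _ _ (filterT : nbhs (0 : R) setT)).
  by apply: is_deriveB; apply: dF2 => //; exact: lt_le_trans d'r.
have properT := interval_limit_point T_int T_nd (I : setT (0 : R)).
pose q h := `|F12 t 0 - (s - t)^-1 * time_quotient phi 0 h|.
have cq : q @ within setT 0^' --> `|F12 t 0 - (s - t)^-1 * (F2 s - F2 t)|.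
  by apply: cvg_norm; apply: cvgB; [exact: cvg_cst|apply: cvgM => //; exact: cvg_cst].
rewrite /time_quotient -(cvg_lim _ cq) //; apply: limr_le;
  first by apply/cvg_ex; eexists; exact: cq.
have nh : \forall h \near within setT (0 : R)^', `|h| < d'.
  rewrite near_withinE; near=> h => _; near: h; exact: dnbhs0_lt.
apply: filterS2 nh (near_within_neq setT 0) => h hd' [_ h0].
have hr : `|h| < r by exact: lt_le_trans d'r.
have [c [Kc cs ec]] : exists c, [/\ K c, `|c - t| <= `|s - t| &
    (F s h - F s 0) - (F t h - F t 0) = (F1 c h - F1 c 0) * (s - t)].
  apply: (@time_MVT K (fun c => F c h - F c 0) (fun c => F1 c h - F1 c 0)) => // c Kc cs.
  have cr : `|c - t| < r by apply: le_lt_trans cs _; exact: lt_le_trans d'r.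
  have h00 : `|0 : R| < r by rewrite normr0.
  have := has_time_deriveD (dF1 _ _ Kc cr hr)
    (has_time_deriveM (has_time_derive_cst _ _ (-1)) (dF1 c 0 Kc cr h00)).
  rewrite mul0r add0r mulN1r.
  by apply: eq_has_time_derive => // z _; rewrite mulN1r.
have cr : `|c - t| < r by apply: le_lt_trans cs _; exact: lt_le_trans d'r.
pose K' := `]- r, r[%classic : set R.
have K'P y : K' y <-> `|y| < r by rewrite /K' /= in_itv /= ltr_norml.
have K'_int : is_interval K' by exact: interval_is_interval.
have K'n y : K' y -> nbhs y K'.
  by move=> Ky; apply: open_nbhs_nbhs; split => //; exact: interval_open.
have K'0 : K' 0 by apply/K'P; rewrite normr0.
have K'_nd : K'° !=set0 by exists 0; exact: K'n.
have [th [K'th thh eth]] := @time_MVT K' (F1 c) (F12 c) 0 h K'_int K'_nd K'0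
    (proj2 (K'P h) hr) (fun y K'y _ => proj1 (is_derive_time _ _ (K'n _ K'y))
       (dF12 c y Kc cr (proj1 (K'P y) K'y))).
rewrite /q (_ : _ * _ = F12 c th).
  rewrite !subr0 in thh; apply: hd => //.
    by apply: le_lt_trans cs _; exact: lt_le_trans d'd.
  by apply: le_lt_trans thh _; exact: lt_le_trans d'd.
have -> : time_quotient phi 0 h = h^-1 * (F12 c th * h * (s - t)).
  rewrite /time_quotient /phi subr0; congr (_ * _).
  by rewrite -[h in F12 c th * h]subr0 -eth -ec; ring.
by field; rewrite h0 subr_eq0.
Unshelve. all: by end_near. Qed.

End Mixed.

(** * Smooth functions of time and space *)

Section SpaceTime.
Context {R : realType}.
Local Notation E := 'rV[R]_3.
Variables (I : set R) (U : set E).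
Hypothesis I_int : is_interval I.
Hypothesis I_nd : I° !=set0.
Hypothesis U_open : open U.
Implicit Types (f : R -> E -> R) (t l m : R) (x : E) (d : option 'I_3).

Definition st_is_derive d f t x l : Prop :=
  if d is Some i then is_derive x (delta_mx 0 i : E) (f t) l
  else has_time_derive I (f ^~ x) t l.

Lemma st_is_deriveP d f t x : st_derivable I d f t x ->
  st_is_derive d f t x (st_partial I d f t x).
Proof.
by case: d => [i|] //= df; apply: DeriveDef.
Qed.

Lemma st_is_derive_val d f t x l : I t -> st_is_derive d f t x l ->
  st_derivable I d f t x /\ st_partial I d f t x = l.
Proof.
case: d => [i|] It /=; first by case.
exact: has_time_deriveP.
Qed.

Definition eq_on f h := forall t x, I t -> U x -> f t x = h t x.

Lemma eq_on_sym f h : eq_on f h -> eq_on h f.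
Proof. by move=> e t x It Ux; rewrite e. Qed.

Lemma near_U x : U x -> \forall y \near x, U y.
Proof. by move=> Ux; apply: open_nbhs_nbhs. Qed.

Lemma eq_st_is_derive d f h t x l : eq_on f h -> I t -> U x ->
  st_is_derive d f t x l -> st_is_derive d h t x l.
Proof.
move=> e It Ux; case: d => [i|] /=.
  apply: near_eq_is_derive; apply: filterS (near_U Ux) => y Uy; exact: e.
by apply: eq_has_time_derive => // s Is; exact: e.
Qed.

Lemma st_is_derive_cst d c t x : st_is_derive d (fun _ _ => c) t x 0.
Proof. by case: d => [i|] /=; [exact: is_derive_cst|exact: has_time_derive_cst]. Qed.

Lemma st_is_deriveD d f h t x l m : st_is_derive d f t x l -> st_is_derive d h t x m ->
  st_is_derive d (fun t x => f t x + h t x) t x (l + m).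
Proof.
case: d => [i|] /= fl hm; last exact: has_time_deriveD.
by apply: (is_derive_eq (is_deriveD fl hm)).
Qed.

Lemma st_is_deriveM d f h t x l m : st_is_derive d f t x l -> st_is_derive d h t x m ->
  st_is_derive d (fun t x => f t x * h t x) t x (l * h t x + f t x * m).
Proof.
case: d => [i|] /=; last exact: has_time_deriveM.
move=> fl hm; apply: (is_derive_eq (is_deriveM fl hm)).
by rewrite /GRing.scale /= addrC (mulrC l).
Qed.

Lemma st_is_deriveV d f t x l : (forall t x, I t -> U x -> f t x != 0) ->
  I t -> U x -> st_is_derive d f t x l ->
  st_is_derive d (fun t x => (f t x)^-1) t x (- ((f t x)^-1 * (f t x)^-1 * l)).
Proof.
move=> f0 It Ux; case: d => [i|] /= fl.
  have [dfl vfl] := fl; have fx0 := f0 _ _ It Ux.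
  apply: DeriveDef; first exact: (derivableV fx0 dfl).
  by rewrite (deriveV fx0 dfl) vfl scaleNr expr2 invfM.
by apply: has_time_deriveV => // s Is; exact: f0.
Qed.

(** The requirement that [st_smooth_on] makes on each iterated derivative. *)
Definition regular f : Prop :=
  {within I `*` U, continuous (fun p : R * E => f p.1 p.2)} /\
  forall t x, I t -> U x -> forall d, st_derivable I d f t x.

(** Smoothness quantifies over lists of directions, and an iterated derivative of
    a product is a sum over sublists.  Counting the order of differentiation
    instead makes the stability results inductive. *)
Fixpoint smooth_upto (n : nat) f : Prop :=
  regular f /\ (if n is m.+1 then forall d, smooth_upto m (st_partial I d f) else True).

Lemma smooth_uptoW n f : smooth_upto n.+1 f -> smooth_upto n f.
Proof. by elim: n f => [|n IH] f [rf df]; split=> // d; exact: IH. Qed.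

Lemma smooth_upto_regular n f : smooth_upto n f -> regular f.
Proof. by case: n => [|n] []. Qed.

Lemma st_smoothP f : st_smooth_on I U f <-> forall n, smooth_upto n f.
Proof.
split=> [sf n|cf ds].
  elim: n f sf => [|n IH] f sf; first by split => //; exact: (sf [::]).
  split; first exact: (sf [::]).
  by move=> d; apply: IH => ds; rewrite -foldr_rcons; exact: sf.
suff : regular (foldr (st_partial I) f ds) by [].
elim/last_ind: ds f cf => [|ds d IH] f cf; first exact: smooth_upto_regular (cf 0%N).
by rewrite foldr_rcons; apply: IH => n; case: (cf n.+1) => _ /(_ d).
Qed.

Lemma st_smooth_partial d f :
  st_smooth_on I U f -> st_smooth_on I U (st_partial I d f).
Proof. by move=> sf ds; rewrite -foldr_rcons; exact: sf. Qed.

Lemma regularP f t x : regular f -> I t -> U x ->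
  forall d, st_is_derive d f t x (st_partial I d f t x).
Proof. by move=> [_ df] It Ux d; apply: st_is_deriveP; exact: df. Qed.

(** Derivatives only see [I `*` U]: [U] is open, and the time derivative is taken
    within [I]. *)
Lemma eq_on_partial d f h : regular f -> eq_on f h ->
  eq_on (st_partial I d f) (st_partial I d h).
Proof.
move=> rf e t x It Ux.
by have [] := st_is_derive_val It (eq_st_is_derive e It Ux (regularP rf It Ux d)).
Qed.

Lemma eq_regular f h : eq_on f h -> regular f -> regular h.
Proof.
move=> e rf; split; last first.
  move=> t x It Ux d.
  by have [] := st_is_derive_val It (eq_st_is_derive e It Ux (regularP rf It Ux d)).
case: rf => cf _; move: cf; apply: subspace_eq_continuous => -[t x]; rewrite inE => -[It Ux].
exact: e.
Qed.

Lemma eq_smooth_upto n f h : eq_on f h -> smooth_upto n f -> smooth_upto n h.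
Proof.
elim: n f h => [|n IH] f h e [rf df]; first by split=> //; exact: eq_regular rf.
split; first exact: eq_regular rf.
by move=> d; apply: IH (df d); exact: eq_on_partial.
Qed.

Lemma eq_on_val d f h : (forall t x, I t -> U x -> st_is_derive d f t x (h t x)) ->
  eq_on h (st_partial I d f).
Proof. by move=> fh t x It Ux; have [] := st_is_derive_val It (fh t x It Ux). Qed.

Lemma smooth_upto_cst n c : smooth_upto n (fun _ _ => c).
Proof.
elim: n c => [|n IH] c.
  split=> //; split; first by apply: continuous_subspaceT => p; exact: cvg_cst.
  by move=> t x It Ux d; have [] := st_is_derive_val It (st_is_derive_cst d c t x).
split; first exact: smooth_upto_regular (IH c).
move=> d; apply: eq_smooth_upto (IH 0); apply: eq_on_val => t x _ _; exact: st_is_derive_cst.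
Qed.

Lemma regularD f h : regular f -> regular h -> regular (fun t x => f t x + h t x).
Proof.
move=> rf rh; split.
  by move=> p; apply: continuousD; [exact: rf.1|exact: rh.1].
move=> t x It Ux d.
by have [] := st_is_derive_val It (st_is_deriveD (regularP rf It Ux d) (regularP rh It Ux d)).
Qed.

Lemma regularM f h : regular f -> regular h -> regular (fun t x => f t x * h t x).
Proof.
move=> rf rh; split.
  by move=> p; apply: continuousM; [exact: rf.1|exact: rh.1].
move=> t x It Ux d.
by have [] := st_is_derive_val It (st_is_deriveM (regularP rf It Ux d) (regularP rh It Ux d)).
Qed.

Lemma regularV f : (forall t x, I t -> U x -> f t x != 0) ->
  regular f -> regular (fun t x => (f t x)^-1).
Proof.
move=> f0 rf; split.
  apply/subspace_continuousP => -[t x] /= [It Ux].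
  apply: cvgV; first exact: f0.
  by have /subspace_continuousP /(_ (t, x)) := rf.1; apply.
move=> t x It Ux d.
by have [] := st_is_derive_val It (st_is_deriveV f0 It Ux (regularP rf It Ux d)).
Qed.

Lemma smooth_uptoD n f h : smooth_upto n f -> smooth_upto n h ->
  smooth_upto n (fun t x => f t x + h t x).
Proof.
elim: n f h => [|n IH] f h [rf df] [rh dh]; split; try exact: regularD; first by [].
move=> d; apply: eq_smooth_upto (IH _ _ (df d) (dh d)); apply: eq_on_val => t x It Ux.
by apply: st_is_deriveD; exact: regularP.
Qed.

(** The Leibniz rule involves the factors themselves besides their derivatives,
    hence [smooth_uptoW]. *)
Lemma smooth_uptoM n f h : smooth_upto n f -> smooth_upto n h ->
  smooth_upto n (fun t x => f t x * h t x).
Proof.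
elim: n f h => [|n IH] f h cf ch.
  by split => //; apply: regularM; [case: cf|case: ch].
split; first by apply: regularM; [case: cf|case: ch].
have [[rf df] [rh dh]] := (cf, ch).
move=> d; have cfd := IH _ _ (df d) (smooth_uptoW ch).
have chd := IH _ _ (smooth_uptoW cf) (dh d).
apply: eq_smooth_upto (smooth_uptoD cfd chd).
by apply: eq_on_val => t x It Ux; apply: st_is_deriveM; exact: regularP.
Qed.

Lemma smooth_uptoV n f : (forall t x, I t -> U x -> f t x != 0) ->
  smooth_upto n f -> smooth_upto n (fun t x => (f t x)^-1).
Proof.
move=> f0; elim: n f f0 => [|n IH] f f0 cf.
  by split => //; apply: regularV => //; case: cf.
split; first by apply: regularV => //; case: cf.
have [rf df] := cf; have iv := IH f f0 (smooth_uptoW cf).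
move=> d; have := smooth_uptoM (smooth_upto_cst n (-1)) (smooth_uptoM (smooth_uptoM iv iv) (df d)).
apply: eq_smooth_upto; apply: eq_on_val => t x It Ux.
by rewrite mulN1r; apply: st_is_deriveV => //; exact: regularP.
Qed.

Lemma st_smooth_cst c : st_smooth_on I U (fun _ _ => c).
Proof. by apply/st_smoothP => n; exact: smooth_upto_cst. Qed.

Lemma st_smoothD f h : st_smooth_on I U f -> st_smooth_on I U h ->
  st_smooth_on I U (fun t x => f t x + h t x).
Proof.
by move=> /st_smoothP sf /st_smoothP sh; apply/st_smoothP => n; exact: smooth_uptoD.
Qed.

Lemma st_smoothM f h : st_smooth_on I U f -> st_smooth_on I U h ->
  st_smooth_on I U (fun t x => f t x * h t x).
Proof.
by move=> /st_smoothP sf /st_smoothP sh; apply/st_smoothP => n; exact: smooth_uptoM.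
Qed.

Lemma st_smoothV f : (forall t x, I t -> U x -> f t x != 0) ->
  st_smooth_on I U f -> st_smooth_on I U (fun t x => (f t x)^-1).
Proof. by move=> f0 /st_smoothP sf; apply/st_smoothP => n; exact: smooth_uptoV. Qed.

Lemma eq_st_smooth f h : eq_on f h -> st_smooth_on I U f -> st_smooth_on I U h.
Proof. by move=> e /st_smoothP sf; apply/st_smoothP => n; exact: eq_smooth_upto (sf n). Qed.

Lemma st_smooth_regular f : st_smooth_on I U f -> regular f.
Proof. by move=> sf; exact: (sf [::]). Qed.

Lemma pair_nbhs (T : topologicalType) (phi : R * R -> T) (t : R) (Q : set T) :
  {for (t, 0), continuous phi} -> nbhs (phi (t, 0)) Q ->
  exists2 e, 0 < e & forall s h : R, `|s - t| < e -> `|h| < e -> Q (phi (s, h)).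
Proof.
move=> cphi /cphi /nbhs_ballP[e /= e0 eQ]; exists e => // s h st h0.
by apply: (eQ (s, h)); split; rewrite /ball /= ?sub0r ?normrN // distrC.
Qed.

Lemma is_derive_line (f : E -> R) (x v : E) (h l : R) :
  is_derive (x + h *: v) v f l ->
  is_derive h (1 : R) (fun h => f (x + h *: v)) l.
Proof.
have e : (fun k : R => k^-1 *: (((fun h => f (x + h *: v)) \o shift h) (k *: 1)
            - f (x + h *: v)))
       = (fun k : R => k^-1 *: ((f \o shift (x + h *: v)) (k *: v)
            - f (x + h *: v))).
  apply: funext => k /=; congr (_ *: (f _ - _)).
  by rewrite [k *: 1]mulr1 scalerDl addrCA.
case=> df vf; apply: DeriveDef; first by rewrite /derivable e.
by rewrite /derive e.
Qed.

Lemma regular_near f t x : regular f -> I t -> U x -> forall e, 0 < e ->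
  \forall p \near (t, x), I p.1 -> U p.2 -> `|f t x - f p.1 p.2| <= e.
Proof.
move=> [cf _] It Ux e e0.
have /subspace_continuousP /(_ (t, x)) := cf => /(_ (conj It Ux)).
move=> /cvgrPdist_le /(_ _ e0).
by rewrite near_withinE; apply: filterS => p h Ip Up; exact: h.
Qed.

(** [mixed_time_derive] along the line through [x] in direction [i]. *)
Lemma st_partialC_time i f t x : st_smooth_on I U f -> I t -> U x ->
  st_partial I None (st_partial I (Some i) f) t x =
  st_partial I (Some i) (st_partial I None f) t x.
Proof.
move=> sf It Ux; set e := (delta_mx 0 i : E).
have rf := st_smooth_regular sf.
have rft := st_smooth_regular (st_smooth_partial None sf).
have rfti := st_smooth_regular (st_smooth_partial (Some i) (st_smooth_partial None sf)).
pose phi (p : R * R) : R * E := (p.1, x + p.2 *: e).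
have phi0 : phi (t, 0) = (t, x) by rewrite /phi /= scale0r addr0.
have cphi : {for (t, 0), continuous phi}.
  have c1 : (fun p : R * R => p.1) @ nbhs (t, 0 : R) --> t by exact: cvg_fst.
  have c2 : (fun p : R * R => x + p.2 *: e) @ nbhs (t, 0 : R) --> x + 0 *: e.
    by apply: cvgD; [exact: cvg_cst|apply: cvgZr_tmp; exact: cvg_snd].
  exact: cvg_pair c1 c2.
have [r r0 rU] : exists2 r, 0 < r & forall s h : R, `|s - t| < r -> `|h| < r ->
    U (x + h *: e).
  apply: (pair_nbhs (Q := fun p => U p.2) cphi); rewrite phi0.
  have c : (fun p : R * E => p.2) @ nbhs (t, x) --> x by exact: cvg_snd.
  exact: c (near_U Ux).
have tt : `|t - t| < r by rewrite subrr normr0.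
have h0r : `|0 : R| < r by rewrite normr0.
have := @mixed_time_derive R I t (fun s h => f s (x + h *: e))
  (fun s h => st_partial I None f s (x + h *: e))
  (fun s h => st_partial I (Some i) (st_partial I None f) s (x + h *: e))
  (fun s => st_partial I (Some i) f s x) r I_int I_nd It r0.
rewrite scale0r addr0 => mix.
suff dt : has_time_derive I (fun s => st_partial I (Some i) f s x) t
    (st_partial I (Some i) (st_partial I None f) t x).
  exact: (proj2 (has_time_deriveP I_int I_nd It dt)).
apply: mix.
- by move=> s h Is st hr; exact: (regularP rf Is (rU _ _ st hr) None).
- move=> s h Is st hr; apply: is_derive_line.
  exact: (regularP rft Is (rU _ _ st hr) (Some i)).
- move=> s Is st; apply: is_derive_line; rewrite scale0r addr0.
  exact: (regularP rf Is Ux (Some i)).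
move=> eps eps0.
have := regular_near rfti It Ux eps0; rewrite -phi0 => /(pair_nbhs cphi)[d d0 dP].
exists (Num.min d r); first by rewrite lt_min d0.
move=> s h Is; rewrite !lt_min => /andP[sd sr] /andP[hd hr].
exact: (dP s h sd hd Is (rU s h sr hr)).
Qed.

(** [mixed_time_derive] in the plane through [x] spanned by the two directions,
    the first of which plays the part of time on a small open interval. *)
Lemma st_partialC_space i j f t x : st_smooth_on I U f -> I t -> U x ->
  st_partial I (Some j) (st_partial I (Some i) f) t x =
  st_partial I (Some i) (st_partial I (Some j) f) t x.
Proof.
move=> sf It Ux; set e := (delta_mx 0 i : E); set e' := (delta_mx 0 j : E).
have rf := st_smooth_regular sf.
have rfi := st_smooth_regular (st_smooth_partial (Some i) sf).
have rfj := st_smooth_regular (st_smooth_partial (Some j) sf).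
have rfji := st_smooth_regular (st_smooth_partial (Some i) (st_smooth_partial (Some j) sf)).
pose phi (p : R * R) : E := x + p.1 *: e' + p.2 *: e.
have phi0 : phi (0, 0) = x by rewrite /phi /= !scale0r !addr0.
have cphi : {for (0, 0), continuous phi}.
  apply: cvgD; last by apply: cvgZr_tmp; exact: cvg_snd.
  by apply: cvgD; [exact: cvg_cst|apply: cvgZr_tmp; exact: cvg_fst].
have [r r0 rU] : exists2 r, 0 < r & forall s h : R, `|s - 0| < r -> `|h| < r ->
    U (x + s *: e' + h *: e).
  by apply: (pair_nbhs cphi); rewrite phi0; exact: near_U.
pose K := `]- r, r[%classic : set R.
have KP y : K y <-> `|y| < r by rewrite /K /= in_itv /= ltr_norml.
have K_int : is_interval K by exact: interval_is_interval.
have Kn y : K y -> nbhs y K.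
  by move=> Ky; apply: open_nbhs_nbhs; split => //; exact: interval_open.
have K0 : K 0 by apply/KP; rewrite normr0.
have K_nd : K° !=set0 by exists 0; exact: Kn.
have := @mixed_time_derive R K 0 (fun s h => f t (x + s *: e' + h *: e))
  (fun s h => st_partial I (Some j) f t (x + s *: e' + h *: e))
  (fun s h => st_partial I (Some i) (st_partial I (Some j) f) t (x + s *: e' + h *: e))
  (fun s => st_partial I (Some i) f t (x + s *: e')) r K_int K_nd K0 r0.
rewrite !scale0r !addr0 => mix.
have d1 : is_derive (0 : R) (1 : R) (fun s => st_partial I (Some i) f t (x + s *: e'))
    (st_partial I (Some j) (st_partial I (Some i) f) t x).
  apply: is_derive_line; rewrite scale0r addr0.
  exact: (regularP rfi It Ux (Some j)).
have [_ e1] := d1.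
suff [_ e2] : is_derive (0 : R) (1 : R) (fun s => st_partial I (Some i) f t (x + s *: e'))
    (st_partial I (Some i) (st_partial I (Some j) f) t x).
  exact: (etrans (esym e1) e2).
apply: (proj2 (is_derive_time _ _ (Kn _ K0))); apply: mix.
- move=> s h Ks st hr; apply/(is_derive_time _ _ (Kn _ Ks)).
  rewrite (_ : (fun s => _) = fun s => f t (x + h *: e + s *: e')); last first.
    by apply: funext => z; rewrite addrAC.
  apply: is_derive_line; rewrite addrAC.
  exact: (regularP rf It (rU _ _ st hr) (Some j)).
- move=> s h Ks st hr; apply: is_derive_line.
  exact: (regularP rfj It (rU _ _ st hr) (Some i)).
- move=> s Ks st; apply: is_derive_line; rewrite scale0r addr0.
  have Us : U (x + s *: e') by have := rU s 0 st; rewrite scale0r addr0 normr0; apply.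
  exact: (regularP rf It Us (Some i)).
move=> eps eps0.
have cphit : {for (0, 0), continuous (fun p => (t, phi p))}.
  have c1 : (fun p : R * R => t) @ nbhs (0 : R, 0 : R) --> t by exact: cvg_cst.
  exact: cvg_pair c1 cphi.
have := regular_near rfji It Ux eps0; rewrite -{1}phi0 => /(pair_nbhs cphit)[d d0 dP].
exists (Num.min d r); first by rewrite lt_min d0.
move=> s h Is; rewrite !lt_min => /andP[sd sr] /andP[hd hr].
exact: (dP s h sd hd It (rU s h sr hr)).
Qed.

End SpaceTime.

(** * The ring of smooth functions *)

Section Chart.
Context {R : realType}.
Local Notation E := 'rV[R]_3.
Variables (I : set R) (U : set E).
Hypothesis I_int : is_interval I.
Hypothesis I_nd : I° !=set0.
Hypothesis U_open : open U.

Local Notation smooth := (st_smooth_on I U).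
Local Notation eq_on := (eq_on I U).

(** Ring elements are functions on [I `*` U] only, so that functions that agree
    there are equal; extending them by zero gives access to derivatives. *)
Definition st_dom := {p : R * E | (I `*` U) p}.

Definition ext (f : st_dom -> R) (t : R) (x : E) : R :=
  if pselect ((I `*` U) (t, x)) is left h then f (exist _ (t, x) h) else 0.

Definition restr (F : R -> E -> R) : st_dom -> R :=
  fun p => F (sval p).1 (sval p).2.

Lemma ext_restr F : eq_on (ext (restr F)) F.
Proof. by move=> t x It Ux; rewrite /ext; case: pselect => // -[]. Qed.

Lemma restr_ext f : restr (ext f) = f.
Proof.
apply: funext => -[[t x] /= h]; rewrite /restr /ext /=.
by case: pselect => // h'; congr (f (exist _ _ _)); exact: Prop_irrelevance.
Qed.

Lemma extD f h : ext (f + h) = fun t x => ext f t x + ext h t x.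
Proof. by do 2!apply: funext => ?; rewrite /ext; case: pselect => // _; rewrite addr0. Qed.

Lemma extM f h : ext (f * h) = fun t x => ext f t x * ext h t x.
Proof. by do 2!apply: funext => ?; rewrite /ext; case: pselect => // _; rewrite mul0r. Qed.

Lemma extN f : ext (- f) = fun t x => -1 * ext f t x.
Proof.
by do 2!apply: funext => ?; rewrite /ext mulN1r; case: pselect => // _; rewrite oppr0.
Qed.

Definition smooth_pred : {pred (st_dom -> R)} := fun f => `[< smooth (ext f) >].

Lemma smooth_predP f : reflect (smooth (ext f)) (f \in smooth_pred).
Proof. exact: asboolP. Qed.

Lemma smooth_restr F : smooth F -> restr F \in smooth_pred.
Proof.
move=> sF; apply/smooth_predP; apply: (eq_st_smooth I_int I_nd U_open) sF.
by apply: eq_on_sym; exact: ext_restr.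
Qed.

Lemma smooth_subring : subring_closed smooth_pred.
Proof.
have s1 : (1 : st_dom -> R) \in smooth_pred.
  by apply: (smooth_restr (F := fun _ _ => 1)); exact: st_smooth_cst.
split=> // f h /smooth_predP sf /smooth_predP sh; apply/smooth_predP.
  rewrite extD extN; apply: st_smoothD => //; apply: st_smoothM => //.
  exact: st_smooth_cst.
by rewrite extM; exact: st_smoothM.
Qed.

Record sfun := SFun { sfun_val : st_dom -> R; _ : sfun_val \in smooth_pred }.

HB.instance Definition _ := [isSub for sfun_val].
HB.instance Definition _ := [Choice of sfun by <:].
HB.instance Definition _ :=
  GRing.SubChoice_isSubComPzRing.Build _ _ sfun smooth_subring.

Definition sfun_of F (sF : smooth F) : sfun := SFun (smooth_restr sF).

(** [a] is the ring element of the function [F].  Such statements are proved by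
    following the syntax of [F]. *)
Definition rep (a : sfun) (F : R -> E -> R) : Prop := eq_on (ext (val a)) F.

Lemma smooth_val (a : sfun) : smooth (ext (val a)).
Proof. by apply/smooth_predP; exact: valP. Qed.

Lemma rep_ext a : rep a (ext (val a)).
Proof. by []. Qed.

Lemma rep_sfun_of F (sF : smooth F) : rep (sfun_of sF) F.
Proof. exact: ext_restr. Qed.

Lemma eq_rep a F G : rep a F -> eq_on F G -> rep a G.
Proof. by move=> aF FG t x It Ux; rewrite aF // FG. Qed.

Lemma rep_inj a b F : rep a F -> rep b F -> a = b.
Proof.
move=> aF bF; apply: val_inj; rewrite -(restr_ext (val a)) -(restr_ext (val b)).
by apply: funext => -[[t x] /= [It Ux]]; rewrite /restr aF // bF.
Qed.

Lemma rep_eq a F G t x : rep a F -> rep a G -> I t -> U x -> F t x = G t x.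
Proof. by move=> aF aG It Ux; rewrite -aF // -aG. Qed.

Lemma repD a b F G : rep a F -> rep b G ->
  rep (a + b) (fun t x => F t x + G t x).
Proof. by move=> aF bG t x It Ux; rewrite extD aF // bG. Qed.

Lemma repM a b F G : rep a F -> rep b G ->
  rep (a * b) (fun t x => F t x * G t x).
Proof. by move=> aF bG t x It Ux; rewrite extM aF // bG. Qed.

Lemma repN a F : rep a F -> rep (- a) (fun t x => - F t x).
Proof. by move=> aF t x It Ux; rewrite extN aF // mulN1r. Qed.

Lemma rep0 : rep 0 (fun _ _ => 0).
Proof. by move=> t x It Ux; rewrite /ext; case: pselect. Qed.

Lemma rep1 : rep 1 (fun _ _ => 1).
Proof. by move=> t x It Ux; rewrite /ext; case: pselect => // -[]. Qed.

Lemma rep_nat n : rep n%:R (fun _ _ => n%:R).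
Proof.
elim: n => [|n IH]; first exact: rep0.
by rewrite mulrS; apply: (eq_rep (repD rep1 IH)) => t x _ _; rewrite mulrS.
Qed.

Lemma rep_sum (a : 'I_3 -> sfun) (F : 'I_3 -> R -> E -> R) :
  (forall i, rep (a i) (F i)) ->
  rep (\sum_i a i) (fun t x => \sum_i F i t x).
Proof.
move=> aF; rewrite DiffAlg.sum3; apply: (eq_rep (repD (repD (aF _) (aF _)) (aF _))).
by move=> t x _ _; rewrite DiffAlg.sum3.
Qed.

Definition st_D d (a : sfun) : sfun :=
  sfun_of (st_smooth_partial d (smooth_val a)).

Lemma rep_st_D d a F : rep a F -> rep (st_D d a) (st_partial I d F).
Proof.
move=> aF; apply: (eq_rep (rep_sfun_of _)).
apply: (eq_on_partial I_int I_nd U_open) aF.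
exact: st_smooth_regular (smooth_val a).
Qed.

Lemma sfun_regular (a : sfun) : regular I U (ext (val a)).
Proof. exact: st_smooth_regular (smooth_val a). Qed.

Lemma st_D_add d a b : st_D d (a + b) = st_D d a + st_D d b.
Proof.
apply: rep_inj (rep_st_D d (repD (rep_ext a) (rep_ext b))) _.
apply: eq_rep (repD (rep_st_D d (rep_ext a)) (rep_st_D d (rep_ext b))) _.
apply: (eq_on_val I_int I_nd) => t x It Ux.
by apply: st_is_deriveD; apply: regularP It Ux _; exact: sfun_regular.
Qed.

Lemma st_D_mul d a b : st_D d (a * b) = st_D d a * b + a * st_D d b.
Proof.
have ra := rep_st_D d (rep_ext a); have rb := rep_st_D d (rep_ext b).
apply: rep_inj (rep_st_D d (repM (rep_ext a) (rep_ext b))) _.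
apply: eq_rep (repD (repM ra (rep_ext b)) (repM (rep_ext a) rb)) _.
apply: (eq_on_val I_int I_nd) => t x It Ux.
by apply: st_is_deriveM; apply: regularP It Ux _; exact: sfun_regular.
Qed.

Lemma st_DC i j a : st_D (Some i) (st_D (Some j) a) = st_D (Some j) (st_D (Some i) a).
Proof.
apply: rep_inj (rep_st_D _ (rep_st_D _ (rep_ext a))) _.
apply: eq_rep (rep_st_D _ (rep_st_D _ (rep_ext a))) _ => t x It Ux.
exact: (st_partialC_space U_open _ _ (smooth_val a)).
Qed.

Lemma st_DC_time i a : st_D None (st_D (Some i) a) = st_D (Some i) (st_D None a).
Proof.
apply: rep_inj (rep_st_D _ (rep_st_D _ (rep_ext a))) _.
apply: eq_rep (rep_st_D _ (rep_st_D _ (rep_ext a))) _ => t x It Ux.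
by rewrite (st_partialC_time I_int I_nd U_open _ (smooth_val a)).
Qed.

(** * The geometry of a metric in the ring *)

Section Metric.
Variable g : R -> E -> 'M[R]_3.
Hypothesis g_smooth : forall i j, smooth (fun t x => g t x i j).
Hypothesis g_sym : forall t x, I t -> U x -> (g t x)^T = g t x.
Hypothesis g_pos : forall t x (v : 'rV[R]_3), I t -> U x -> v != 0 ->
  0 < (v *m g t x *m v^T) 0 0.

Lemma smooth_sum (S : finType) (Q : pred S) (F : S -> R -> E -> R) :
  (forall s, smooth (F s)) -> smooth (fun t x => \sum_(s | Q s) F s t x).
Proof.
move=> sF; elim: (index_enum S) => [|s r IH].
  rewrite (_ : (fun t x => _) = fun _ _ => 0); first exact: st_smooth_cst.
  by do 2!apply: funext => ?; rewrite big_nil.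
rewrite (_ : (fun t x => _) = fun t x =>
    (if Q s then F s t x else 0) + \sum_(s <- r | Q s) F s t x).
  by apply: st_smoothD IH => //; case: (Q s) => //; exact: st_smooth_cst.
by do 2!apply: funext => ?; rewrite big_cons; case: (Q s); rewrite ?add0r.
Qed.

Lemma smooth_prod (S : finType) (F : S -> R -> E -> R) :
  (forall s, smooth (F s)) -> smooth (fun t x => \prod_s F s t x).
Proof.
move=> sF; elim: (index_enum S) => [|s r IH].
  rewrite (_ : (fun t x => _) = fun _ _ => 1); first exact: st_smooth_cst.
  by do 2!apply: funext => ?; rewrite big_nil.
rewrite (_ : (fun t x => _) = fun t x => F s t x * \prod_(s <- r) F s t x).
  exact: st_smoothM.
by do 2!apply: funext => ?; rewrite big_cons.
Qed.

Lemma smooth_det n (B : R -> E -> 'M[R]_n) :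
  (forall i j, smooth (fun t x => B t x i j)) -> smooth (fun t x => \det (B t x)).
Proof.
move=> sB; apply: smooth_sum => s.
apply: st_smoothM => //; first exact: st_smooth_cst.
exact: smooth_prod.
Qed.

Lemma det_metric t x : I t -> U x -> \det (g t x) != 0.
Proof.
move=> It Ux; apply/det0P => -[v v0 vg].
by have := g_pos It Ux v0; rewrite vg mul0mx mxE ltxx.
Qed.

Lemma unit_metric t x : I t -> U x -> g t x \in unitmx.
Proof. by move=> It Ux; rewrite unitmxE unitfE det_metric. Qed.

(** Cramer's rule; positivity keeps the determinant away from zero. *)
Lemma smooth_ginv i j : smooth (fun t x => ginv (g t) i j x).
Proof.
have h : smooth (fun t x => (\det (g t x))^-1 *
    ((-1) ^+ (j + i) * \det (row' j (col' i (g t x))))).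
  apply: st_smoothM => //.
    by apply: st_smoothV => //; [exact: det_metric|exact: smooth_det].
  apply: st_smoothM => //; first exact: st_smooth_cst.
  apply: smooth_det => k l.
  rewrite (_ : (fun t x => _) = fun t x => g t x (lift j k) (lift i l)) //.
  by do 2!apply: funext => ?; rewrite !mxE.
apply: (eq_st_smooth I_int I_nd U_open) h => t x It Ux.
by rewrite /ginv /invmx unit_metric // !mxE.
Qed.

Definition gA i j : sfun := sfun_of (g_smooth i j).
Definition HA i j : sfun := sfun_of (smooth_ginv i j).
Definition halfA : sfun := sfun_of (st_smooth_cst I_int I_nd U_open 2^-1).

Lemma gAC i j : gA i j = gA j i.
Proof.
apply: rep_inj (rep_sfun_of _) _; apply: eq_rep (rep_sfun_of _) _ => t x It Ux.
by rewrite -[in LHS]g_sym // mxE.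
Qed.

Lemma HAC i j : HA i j = HA j i.
Proof.
apply: rep_inj (rep_sfun_of _) _; apply: eq_rep (rep_sfun_of _) _ => t x It Ux.
by rewrite /ginv -[in LHS](g_sym It Ux) -trmx_inv mxE.
Qed.

Lemma halfA2 : halfA + halfA = 1.
Proof.
apply: rep_inj (repD (rep_sfun_of _) (rep_sfun_of _)) _; apply: eq_rep rep1 _ => t x _ _.
by field.
Qed.

Lemma rep_delta i j : rep (DiffAlg.delta sfun i j) (fun _ _ => (i == j)%:R).
Proof. exact: rep_nat. Qed.

Lemma HgA i j : \sum_m HA i m * gA m j = DiffAlg.delta sfun i j.
Proof.
apply: rep_inj (rep_sum (fun m => repM (rep_sfun_of _) (rep_sfun_of _))) _.
apply: eq_rep (rep_delta i j) _ => t x It Ux.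
have := congr1 (fun B : 'M[R]_3 => B i j) (mulVmx (unit_metric It Ux)).
by rewrite !mxE => <-.
Qed.

Local Notation D := (fun i => st_D (Some i)).
Local Notation gamA := (DiffAlg.gam halfA D gA HA).

Lemma rep_g i j : rep (gA i j) (fun t x => g t x i j).
Proof. exact: rep_sfun_of. Qed.

Lemma rep_H i j : rep (HA i j) (fun t x => ginv (g t) i j x).
Proof. exact: rep_sfun_of. Qed.

Lemma rep_half : rep halfA (fun _ _ => 2^-1).
Proof. exact: rep_sfun_of. Qed.

Lemma repB a b F G : rep a F -> rep b G ->
  rep (a - b) (fun t x => F t x - G t x).
Proof. by move=> aF bG; apply: repD => //; exact: repN. Qed.

Lemma rep_D i a F : rep a F -> rep (st_D (Some i) a) (fun t x => partial i (F t) x).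
Proof. exact: rep_st_D. Qed.

Lemma rep_gam k i j : rep (gamA k i j) (fun t x => christoffel (g t) k i j x).
Proof.
rewrite /DiffAlg.gam -lock; apply: repM rep_half _; apply: rep_sum => l.
apply: repM (rep_H _ _) _; apply: repB; first apply: repD; exact: rep_D (rep_g _ _).
Qed.

Lemma rep_rm l k i j :
  rep (DiffAlg.rm halfA D gA HA l k i j) (fun t x => riemann (g t) l k i j x).
Proof.
apply: repD; first by apply: repB; apply: rep_D (rep_gam _ _ _).
by apply: rep_sum => m; apply: repB; apply: repM; exact: rep_gam.
Qed.

Lemma rep_ric i j : rep (DiffAlg.ric halfA D gA HA i j) (fun t x => ricci (g t) i j x).
Proof. by apply: rep_sum => l; exact: rep_rm. Qed.

Lemma rep_scal : rep (DiffAlg.scal halfA D gA HA) (fun t x => scal (g t) x).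
Proof.
by apply: rep_sum => i; apply: rep_sum => j; apply: repM; [exact: rep_H|exact: rep_ric].
Qed.

Lemma rep_ric_up i j : rep (DiffAlg.ric_up halfA D gA HA i j) (fun t x => ricci_up (g t) i j x).
Proof.
apply: rep_sum => a; apply: rep_sum => b.
by apply: repM; [apply: repM; exact: rep_H|exact: rep_ric].
Qed.

Lemma rep_ric_norm2 : rep (DiffAlg.ric_norm2 halfA D gA HA) (fun t x => ricci_norm2 (g t) x).
Proof.
by apply: rep_sum => a; apply: rep_sum => b; apply: repM; [exact: rep_ric_up|exact: rep_ric].
Qed.

Lemma rep_nab2 TA T a i j : (forall i j, rep (TA i j) (fun t x => T t i j x)) ->
  rep (DiffAlg.nab2 halfA D gA HA TA a i j) (fun t x => nabla2 (g t) (T t) a i j x).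
Proof.
move=> rT; apply: repB; first apply: repB; first exact: rep_D.
  all: by apply: rep_sum => m; apply: repM => //; exact: rep_gam.
Qed.

Lemma rep_nab3 TA T a i j k : (forall i j k, rep (TA i j k) (fun t x => T t i j k x)) ->
  rep (DiffAlg.nab3 halfA D gA HA TA a i j k) (fun t x => nabla3 (g t) (T t) a i j k x).
Proof.
move=> rT; do 2!(apply: repB; last by apply: rep_sum => m; apply: repM => //; exact: rep_gam).
apply: repB; last by apply: rep_sum => m; apply: repM => //; exact: rep_gam.
exact: rep_D.
Qed.

Lemma rep_nab4 TA T a i j k l :
  (forall i j k l, rep (TA i j k l) (fun t x => T t i j k l x)) ->
  rep (DiffAlg.nab4 halfA D gA HA TA a i j k l) (fun t x => nabla4 (g t) (T t) a i j k l x).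
Proof.
move=> rT; do 3!(apply: repB; last by apply: rep_sum => m; apply: repM => //; exact: rep_gam).
apply: repB; last by apply: rep_sum => m; apply: repM => //; exact: rep_gam.
exact: rep_D.
Qed.

Local Notation CA := (DiffAlg.cotton_tensor halfA D gA HA).

(** On the right is the Cotton tensor as it is usually defined, on the left the
    antisymmetrised derivative of the Schouten tensor. *)
Lemma rep_cotton i j k : rep (CA i j k) (fun t x => cotton (g t) i j k x).
Proof.
rewrite (DiffAlg.cotton_tensorE halfA2 (fun i => st_D_add (Some i)) (fun i => st_D_mul (Some i))
  gAC HAC HgA).
apply: repB; first by apply: repB; apply: rep_nab2 => *; exact: rep_ric.
have r4 : rep (halfA * halfA) (fun _ _ => 4^-1).
  by apply: (eq_rep (repM rep_half rep_half)) => t x _ _; field.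
apply: repM r4 _.
by apply: repB; apply: repM (rep_g _ _); exact: rep_D rep_scal.
Qed.

Lemma rep_laplacian i j k :
  rep (DiffAlg.trace HA (fun a b =>
      DiffAlg.nab4 halfA D gA HA (DiffAlg.nab3 halfA D gA HA CA) a b i j k))
    (fun t x => laplacian3 (g t) (cotton (g t)) i j k x).
Proof.
apply: rep_sum => a; apply: rep_sum => b; apply: repM; first exact: rep_H.
apply: (rep_nab4 (T := fun t => nabla3 (g t) (cotton (g t)))) => *.
by apply: (rep_nab3 (T := fun t => cotton (g t))) => *; exact: rep_cotton.
Qed.

Hypothesis g_flow : forall t x i j, I t -> U x ->
  time_derive I (fun s => g s x i j) t = - 2 * ricci (g t) i j x.

Lemma flowA i j : st_D None (gA i j) = - 2%:R * DiffAlg.ric halfA D gA HA i j.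
Proof.
apply: rep_inj (rep_st_D None (rep_g i j)) _.
apply: eq_rep (repM (repN (rep_nat 2)) (rep_ric i j)) _ => t x It Ux /=.
by rewrite g_flow.
Qed.

Theorem chart_cotton_evolution t x i j k : I t -> U x ->
   let G := g t x in
   let Gi p q := ginv (g t) p q x in
   let Ric p q := ricci (g t) p q x in
   let Ricup p q := ricci_up (g t) p q x in
   let dRic a p q := nabla2 (g t) (ricci (g t)) a p q x in
   let S := scal (g t) x in
   let dS a := partial a (scal (g t)) x in
   let dRic2 a := partial a (ricci_norm2 (g t)) x in
   let C p q r := cotton (g t) p q r x in
   time_derive I (fun s => cotton (g s) i j k x) t
     - laplacian3 (g t) (cotton (g t)) i j k x
   = \sum_p \sum_q Gi p q * Ric p j * (C k q i + C q k i)
     + 5 * (\sum_p \sum_q Gi p q * Ric i p * C q k j)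
     + \sum_p \sum_q Gi p q * Ric p k * (C j i q + C q i j)
     + 2 * S * C i j k
     + 2 * (\sum_q \sum_l Ricup q l * C q j l) * G i k
     - 2 * (\sum_q \sum_l Ricup q l * C q k l) * G i j
     + 2^-1 * dRic2 k * G i j - 2^-1 * dRic2 j * G i k
     + S / 2 * dS j * G i k - S / 2 * dS k * G i j
     + 2 * (\sum_p \sum_q Gi p q * Ric p k * dRic j q i)
     - 2 * (\sum_p \sum_q Gi p q * Ric p j * dRic k q i)
     + Ric i j * dS k - Ric i k * dS j.
Proof.
move=> It Ux /=.
have e := DiffAlg.cotton_evolution_alg halfA2 (fun i => st_D_add (Some i))
  (fun i => st_D_mul (Some i)) st_DC gAC HAC HgA (st_D_add None) (st_D_mul None)
  st_DC_time flowA i j k.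
have rC := rep_cotton; have rS := rep_scal; have rR := rep_ric.
have rN := rep_ric_norm2; have rU := rep_ric_up; have rH := rep_H; have rG := rep_g.
have rDR a p q : rep (DiffAlg.nab2 halfA D gA HA (DiffAlg.ric halfA D gA HA) a p q)
    (fun t x => nabla2 (g t) (ricci (g t)) a p q x).
  by apply: rep_nab2 => *; exact: rR.
have L := repB (rep_st_D None (rC i j k)) (rep_laplacian i j k).
rewrite e in L.
pattern t, x; match goal with |- (fun t x => _ = @?G t x) _ _ =>
  refine (rep_eq (G := G) L _ It Ux) end.
(* The two sides have the same shape; descend along it down to the tensors. *)
repeat lazymatch goal with
  | |- rep (- _)%R _ => apply: repN
  | |- rep (_ + _)%R _ => apply: repD
  | |- rep (_ * _)%R _ => apply: repM
  | |- rep (_ *+ _)%R _ => apply: rep_nat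
  | |- rep (bigop.body _ _ _) _ => apply: rep_sum => ?
  | |- rep (DiffAlg.cotton_tensor _ _ _ _ _ _ _) _ => apply: rC
  | |- rep (DiffAlg.scal _ _ _ _) _ => apply: rS
  | |- rep (DiffAlg.ric _ _ _ _ _ _) _ => apply: rR
  | |- rep (DiffAlg.ric_up _ _ _ _ _ _) _ => apply: rU
  | |- rep (DiffAlg.nab2 _ _ _ _ _ _ _ _) _ => apply: rDR
  | |- rep (gA _ _) _ => apply: rG
  | |- rep (HA _ _) _ => apply: rH
  | |- rep halfA _ => apply: rep_half
  | |- rep (st_D _ (DiffAlg.ric_norm2 _ _ _ _)) _ => apply: (rep_D _ rN)
  | |- rep (st_D _ _) _ => apply: (rep_D _ rS)
  end.
Qed.

(** The Cotton tensor is zero as a ring element, and derivations map zero to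
    zero. *)
Lemma chart_cotton_flat t x i j k :
  (forall t x i j k, I t -> U x -> cotton (g t) i j k x = 0) -> I t -> U x ->
  time_derive I (fun s => cotton (g s) i j k x) t
    - laplacian3 (g t) (cotton (g t)) i j k x = 0.
Proof.
move=> C0 It Ux.
have L := repB (rep_st_D None (rep_cotton i j k)) (rep_laplacian i j k).
have CA0 : CA = fun _ _ _ => 0.
  apply: funext => p; apply: funext => q; apply: funext => r.
  apply: rep_inj (rep_cotton p q r) _; apply: eq_rep rep0 _ => s y Is Uy.
  by rewrite C0.
have Dz i' : st_D (Some i') 0 = 0 := DiffAlg.D0 (fun i => st_D_add (Some i)) i'.
have Dtz : st_D None 0 = 0 := DiffAlg.Dt0 (st_D_add None).
have n3 : DiffAlg.nab3 halfA D gA HA (fun _ _ _ => 0) = fun _ _ _ _ => 0.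
  by do 4!apply: funext => ?; rewrite /DiffAlg.nab3 !DiffAlg.sum3 Dz; ring.
have n4 : DiffAlg.nab4 halfA D gA HA (fun _ _ _ _ => 0) = fun _ _ _ _ _ => 0.
  by do 5!apply: funext => ?; rewrite /DiffAlg.nab4 !DiffAlg.sum3 Dz; ring.
have e0 : st_D None (0 : sfun) - DiffAlg.trace HA (fun a b => 0) = 0.
  by rewrite Dtz /DiffAlg.trace !DiffAlg.sum3; ring.
rewrite CA0 n3 n4 e0 in L.
exact: (rep_eq L rep0 It Ux).
Qed.

End Metric.

End Chart.

(** Without the Cotton terms, twice the evolution equation. *)
Lemma flat_identity (F : realFieldType) (G Gi Ric Ricup : 'I_3 -> 'I_3 -> F)
    (dRic C : 'I_3 -> 'I_3 -> 'I_3 -> F) (S : F) (dS dRic2 : 'I_3 -> F)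
    (i j k : 'I_3) :
  (forall p q r, C p q r = 0) ->
  0 = \sum_p \sum_q Gi p q * Ric p j * (C k q i + C q k i)
     + 5 * (\sum_p \sum_q Gi p q * Ric i p * C q k j)
     + \sum_p \sum_q Gi p q * Ric p k * (C j i q + C q i j)
     + 2 * S * C i j k
     + 2 * (\sum_q \sum_l Ricup q l * C q j l) * G i k
     - 2 * (\sum_q \sum_l Ricup q l * C q k l) * G i j
     + 2^-1 * dRic2 k * G i j - 2^-1 * dRic2 j * G i k
     + S / 2 * dS j * G i k - S / 2 * dS k * G i j
     + 2 * (\sum_p \sum_q Gi p q * Ric p k * dRic j q i)
     - 2 * (\sum_p \sum_q Gi p q * Ric p j * dRic k q i)
     + Ric i j * dS k - Ric i k * dS j ->
  0 = dRic2 k * G i j - dRic2 j * G i k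
       + S * dS j * G i k - S * dS k * G i j
       + 4 * (\sum_p \sum_q Gi p q * Ric p k * dRic j q i)
       - 4 * (\sum_p \sum_q Gi p q * Ric p j * dRic k q i)
       + 2 * Ric i j * dS k - 2 * Ric i k * dS j.
Proof.
move=> C0; have -> : C = fun _ _ _ => 0 by do 3!apply: funext => ?.
set X := \sum_p \sum_q _ * _ * dRic j _ _; set Y := \sum_p \sum_q _ * _ * dRic k _ _.
rewrite !DiffAlg.sum3 => e; have := congr1 ( *%R 2) e.
by rewrite mulr0 => ->; field.
Qed.

(** * The theorem *)

Theorem proposition2p1 (R : realType) (M : manifold3 R) (I : set R)
    (I_interval : is_interval I) (I_nondegenerate : I° !=set0)
    (g : chart M -> R -> 'rV[R]_3 -> 'M[R]_3) (g_flow : ricci_flow I g) :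
  (forall (c : chart M) (t : R) (x : 'rV[R]_3), I t -> chart_range c x ->
   forall i j k : 'I_3,
   let G := g c t x in
   let Gi p q := ginv (g c t) p q x in
   let Ric p q := ricci (g c t) p q x in
   let Ricup p q := ricci_up (g c t) p q x in
   let dRic a p q := nabla2 (g c t) (ricci (g c t)) a p q x in
   let S := scal (g c t) x in
   let dS a := partial a (scal (g c t)) x in
   let dRic2 a := partial a (ricci_norm2 (g c t)) x in
   let C p q r := cotton (g c t) p q r x in
   time_derive I (fun s => cotton (g c s) i j k x) t
     - laplacian3 (g c t) (cotton (g c t)) i j k x
   = \sum_p \sum_q Gi p q * Ric p j * (C k q i + C q k i)
     + 5 * (\sum_p \sum_q Gi p q * Ric i p * C q k j)
     + \sum_p \sum_q Gi p q * Ric p k * (C j i q + C q i j)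
     + 2 * S * C i j k
     + 2 * (\sum_q \sum_l Ricup q l * C q j l) * G i k
     - 2 * (\sum_q \sum_l Ricup q l * C q k l) * G i j
     + 2^-1 * dRic2 k * G i j - 2^-1 * dRic2 j * G i k
     + S / 2 * dS j * G i k - S / 2 * dS k * G i j
     + 2 * (\sum_p \sum_q Gi p q * Ric p k * dRic j q i)
     - 2 * (\sum_p \sum_q Gi p q * Ric p j * dRic k q i)
     + Ric i j * dS k - Ric i k * dS j)
  /\
  ((forall (c : chart M) (t : R) (x : 'rV[R]_3), I t -> chart_range c x ->
    forall i j k : 'I_3, cotton (g c t) i j k x = 0) ->
   forall (c : chart M) (t : R) (x : 'rV[R]_3), I t -> chart_range c x ->
   forall i j k : 'I_3,
   let G := g c t x in
   let Gi p q := ginv (g c t) p q x in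
   let Ric p q := ricci (g c t) p q x in
   let dRic a p q := nabla2 (g c t) (ricci (g c t)) a p q x in
   let S := scal (g c t) x in
   let dS a := partial a (scal (g c t)) x in
   let dRic2 a := partial a (ricci_norm2 (g c t)) x in
   0 = dRic2 k * G i j - dRic2 j * G i k
       + S * dS j * G i k - S * dS k * G i j
       + 4 * (\sum_p \sum_q Gi p q * Ric p k * dRic j q i)
       - 4 * (\sum_p \sum_q Gi p q * Ric p j * dRic k q i)
       + 2 * Ric i j * dS k - 2 * Ric i k * dS j).
Proof.
have [[g_smooth g_sym g_pos _] flow] := g_flow.
have evol c t x (It : I t) (Ux : chart_range c x) i j k :=
  chart_cotton_evolution I_interval I_nondegenerate (@chart_range_open R M c)
    (@g_smooth c) (@g_sym c) (@g_pos c) (@flow c) i j k It Ux.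
split; first by move=> c t x It Ux i j k; exact: evol.
move=> C0 c t x It Ux i j k.
have e := evol c t x It Ux i j k; move: e.
rewrite (chart_cotton_flat I_interval I_nondegenerate (@chart_range_open R M c)
  (@g_smooth c) (@g_sym c) (@g_pos c)) //; last by move=> s y p q r Is Uy; exact: C0.
exact: (@flat_identity R (g c t x) (fun p q => ginv (g c t) p q x)
  (fun p q => ricci (g c t) p q x) (fun p q => ricci_up (g c t) p q x)
  (fun a p q => nabla2 (g c t) (ricci (g c t)) a p q x)
  (fun p q r => cotton (g c t) p q r x) (scal (g c t) x)
  (fun a => partial a (scal (g c t)) x) (fun a => partial a (ricci_norm2 (g c t)) x)
  i j k (C0 c t x It Ux)).
Qed.
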